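(* Let $(X,\mathrm{d}\mu)$ be a $\sigma$-finite measure space and let $Y_1,\dots,Y_d$ be measure spaces. Let $1\le p_j<\infty$ for $1\le j\le d$, and let $\theta_j\ge 0$ satisfy $\sum_{j=1}^d\theta_j=1$. Let $T_j:\mathcal{S}(Y_j)\to\mathcal{M}(X)$ be positive linear operators, each of which saturates $X$. Suppose that $$\int_X\prod_{j=1}^d(T_jf_j)(x)^{p_j\theta_j}\,\mathrm{d}\mu(x)\le B\prod_{j=1}^d\|f_j\|_{L^{p_j}(Y_j)}^{p_j\theta_j}$$ for all nonnegative simple functions $f_j\in\mathcal{S}(Y_j)$, $1\le j\le d$. Then there exist nonnegative measurable functions $\phi_1,\dots,\phi_d$ on $X$ such that $$\prod_{j=1}^d\phi_j(x)^{\theta_j}\ge 1\quad\text{for a.e. }x\in X,$$ and such that for each $j$, $$\left(\int_X|T_jf_j(x)|^{p_j}\phi_j(x)\,\mathrm{d}\mu(x)\right)^{1/p_j}\le B^{1/p_j}\|f_j\|_{L^{p_j}(Y_j)}\quad\text{for all } f_j\in\mathcal{S}(Y_j).$$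
   Context: $\mathcal{M}(X)$ is the class of measurable functions on $X$. $\mathcal{S}(Y_j)$ is the space of simple functions on $Y_j$ (with finite norm), equipped with the $L^{p_j}(Y_j)$-norm. A linear operator is positive if it maps nonnegative functions to (a.e.) nonnegative functions. A linear map $T:\mathcal{Y}\to\mathcal{M}(X)$ saturates $X$ if for each measurable $E\subseteq X$ of positive measure there exist a measurable $E'\subseteq E$ with $\mu(E')>0$ and an $h\in\mathcal{Y}$ such that $|Th|>0$ a.e. on $E'$. The convention is $t^0=1$ for all $t\geq 0$ (relevant when some $\theta_j=0$). *)

(* Defs.v *)
From HB Require Import structures.
From mathcomp Require Export all_boot all_order all_algebra.
From mathcomp Require Export all_classical all_reals all_analysis.
Import Order.TTheory GRing.Theory Num.Theory.
Import numFieldNormedType.Exports.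

Set Implicit Arguments.
Unset Strict Implicit.
Unset Printing Implicit Defensive.

Local Open Scope classical_set_scope.
Local Open Scope ring_scope.

Section Defs.
Context {R : realType}.

(* Elements are functions, not classes modulo [nu]-null sets. *)
Definition simpleLp {dY} {Y : measurableType dY}
    (nu : {measure set Y -> \bar R}) (p : R) : set (Y -> R) :=
  [set f | f \in sfun /\ finite_norm nu p%:E f].

(* An operator S -> M(X) is a total function on [Y -> R] whose values off S are
   never used.  Identities in M(X) hold [mu]-almost everywhere. *)
Section Operators.
Context {dX} {X : measurableType dX} (mu : {measure set X -> \bar R}).
Context {Y : Type} (S : set (Y -> R)) (T : (Y -> R) -> X -> R).

Definition measurable_valued : Prop :=
  forall f, S f -> measurable_fun [set: X] (T f).

Definition linear_operator : Prop :=
  forall (a : R) (f g : Y -> R), S f -> S g ->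
    {ae mu, forall x, T (a *: f + g) x = a * T f x + T g x}.

Definition positive_operator : Prop :=
  forall f, S f -> (forall y, 0 <= f y) -> {ae mu, forall x, 0 <= T f x}.

Definition saturates : Prop :=
  forall E : set X, measurable E -> (0 < mu E)%E ->
    exists E' : set X, [/\ measurable E', E' `<=` E, (0 < mu E')%E &
      exists2 h, S h & {ae mu, forall x, E' x -> 0 < `|T h x|}].

End Operators.
End Defs.

(* Main.v *)
Require Import Defs.
From mathcomp Require Import ring lra measurable_realfun.
Import Order.TTheory GRing.Theory Num.Theory.
Import numFieldNormedType.Exports.

(** For each [j] with [0 < theta j], consider the pairs [(G, c)] with
    [0 <= G <= (T j f) `^ p j] almost everywhere for some simple [f >= 0] with
    [||f|| `^ p j <= c]. A positive operator satisfies the reverse Minkowski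
    inequality [operator_pmean], so these pairs form a convex cone
    ([operator_cone]). The hypothesis bounds the integral of the geometric mean of
    the [G j] by [B] times the geometric mean of the costs [c j]; the conclusion
    asks for weights whose geometric mean is at least 1 and for which
    [\int G * phi j <= B * c] on each cone. By Hoelder's inequality the
    conclusion implies the hypothesis; the theorem is the converse, a duality
    statement ([cone_factorization]) that rests on a minimax argument.

    For finitely many constraints and a small loss [delta]
    ([finite_factorization]): the admissible weights form a convex set, on which
    each [\int G * phi j] is affine. If every admissible weight violated some
    constraint, then by [convexlike_minimax] every one would violate a single
    positive combination of them. By convexity of the cones this combination
    involves one pair [(H j, C j)] for each [j]. The weights
    [phi j = (C j / \prod C `^ theta) * (\prod H `^ theta / H j)]
    have geometric mean 1 and make all the integrals [\int H j * phi j] equal to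
    [C j / \prod C `^ theta] times the integral of the geometric mean of [H],
    hence at most [B * C j]: no violation. ([positive_majorant] makes the
    division by [H j] harmless.)

    To satisfy all constraints at once, note that finite sets of constraints cut
    out a downward directed family of nonempty convex sets of weights. The
    bounded strictly convex functional [\sum_j \int w * exp (- phi j)] selects a
    point of their intersection: elements that nearly minimize it are close to
    each other, by the parallelogram law applied to [exp (- phi / 2)], so they
    converge almost everywhere, to the same limit whichever further constraint is
    imposed ([directed_compactness]). By Fatou's lemma the limit satisfies every
    constraint, and saturation prevents it from being infinite on a set of
    positive measure. For indices with [theta j = 0] the weight 0 is enough. *)

Set Implicit Arguments.
Unset Strict Implicit.
Unset Printing Implicit Defensive.

Local Open Scope classical_set_scope.
Local Open Scope ring_scope.

(** * A minimax theorem *)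

Section Minimax.
Context {R : realType} {V : Type}.

(** Ky Fan's notion: the weakest form of convexity under which the separation
    argument below works; it asks for no linear structure on [V]. *)
Definition convexlike {I : Type} (K : set V) (f : I -> V -> R) : Prop :=
  forall u v t, K u -> K v -> 0 <= t -> t <= 1 ->
    exists2 w, K w & forall i, f i w <= t * f i u + (1 - t) * f i v.

(** In the plane of values [(f, h)], the points of [K] avoid the quadrant
    [f <= 0, h < 0], so a line through the origin separates; its slope is the
    supremum of [- h / f] over the points with [h < 0]. *)
Lemma two_function_minimax (K : set V) (f h : V -> R) :
  convexlike K (fun b : bool => if b then f else h) ->
  (forall v, K v -> f v <= 0 -> 0 <= h v) ->
  exists s t, [/\ 0 <= s, 0 <= t, 0 < s + t &
    forall v, K v -> 0 <= s * f v + t * h v].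
Proof.
move=> cvxK fh.
have cross a b : K a -> K b -> h a < 0 -> f b < 0 -> h a * f b <= f a * h b.
  move=> Ka Kb ha fb; rewrite leNgt; apply/negP => lt_ab.
  have fa : 0 < f a by rewrite ltNge; apply/negP => /(fh _ Ka); rewrite leNgt ha.
  have D0 : 0 < f a - f b by lra.
  (* the convex combination of [a] and [b] at which the bound for [f] is 0 *)
  have [||||w Kw fw] := cvxK a b (- f b / (f a - f b)); [by []|by []| | |].
  - by rewrite divr_ge0// ?ltW//; lra.
  - by rewrite ler_pdivrMr//; lra.
  have E g : - f b / (f a - f b) * g a + (1 - - f b / (f a - f b)) * g b =
      (f a * g b - f b * g a) / (f a - f b).
    by field; rewrite gt_eqF.
  have := fw true; rewrite /= E.
  rewrite (_ : f a * f b - f b * f a = 0) ?mul0r; last by ring.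
  move=> /(fh _ Kw); rewrite leNgt => /negP; apply.
  apply: le_lt_trans (fw false) _; rewrite /= E.
  by rewrite ltr_pdivrMr// mul0r; lra.
have [noneg|/existsNP[b0 /not_implyP[Kb0 /negP]]] :=
    pselect (forall v, K v -> 0 <= f v).
  by exists 1, 0; split; rewrite ?addr0// => v /noneg; lra.
rewrite -ltNge => fb0.
(* the slopes [r] forced on a separating line [r * f + h] by the points below it *)
pose A := [set r | exists2 a, K a /\ h a < 0 & r = - h a / f a].
have fA a : K a -> h a < 0 -> 0 < f a.
  by move=> Ka ha; rewrite ltNge; apply/negP => /(fh _ Ka); rewrite leNgt ha.
have ubA b : K b -> f b < 0 -> ubound A (h b / - f b).
  move=> Kb fb _ [a [Ka ha] ->]; have fa := fA a Ka ha.
  rewrite ler_pdivrMr// mulrAC ler_pdivlMr; last lra.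
  by have := cross a b Ka Kb ha fb; lra.
have [A0|/set0P An0] := eqVneq A set0.
  exists 0, 1; split; rewrite ?add0r// => v Kv; rewrite mul0r add0r mul1r.
  rewrite leNgt; apply/negP => hv.
  by have : A (- h v / f v) by [exists v]; rewrite A0.
have supA : has_sup A by split=> //; exists (h b0 / - f b0); exact: ubA.
have rho0 : 0 <= sup A.
  have [r Ar] := An0; have := ub_le_sup supA.2; move=> /(_ _ Ar); apply: le_trans.
  have [a [Ka ha] ->] := Ar.
  by rewrite divr_ge0// ?ltW ?(fA a)//; lra.
exists (sup A), 1; split => //; first lra.
move=> v Kv; rewrite mul1r.
have [hv|hv] := ltP (h v) 0.
  have fv := fA v Kv hv.
  have : - h v / f v <= sup A by apply: (ub_le_sup supA.2); exists v.
  by rewrite ler_pdivrMr//; lra.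
have [fv|fv] := ltP (f v) 0; last by rewrite addr_ge0// mulr_ge0.
have : sup A <= h v / - f v by apply: (ge_sup An0); exact: ubA.
by rewrite ler_pdivlMr; lra.
Qed.

(** By induction on the number of functions: on the subset where the first one is
    nonpositive, some combination [h] of the others is nonnegative, and
    [two_function_minimax] combines [h] with the first. *)
Lemma convexlike_minimax (n : nat) (K : set V) (f : 'I_n.+1 -> V -> R) :
  convexlike K f -> (forall v, K v -> exists k, 0 < f k v) ->
  exists lam : 'I_n.+1 -> R, [/\ forall k, 0 <= lam k, 0 < \sum_k lam k &
    forall v, K v -> 0 <= \sum_k lam k * f k v].
Proof.
elim: n K f => [|n IH] K f cvxK fpos.
  exists (fun=> 1); split; rewrite ?big_ord1// => v Kv.
  by rewrite big_ord1 mul1r; have [k /ltW] := fpos v Kv; rewrite (ord1 k).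
pose K' := [set v | K v /\ f ord0 v <= 0].
have [||mu [mu0 smu muP]] := IH K' (fun k => f (lift ord0 k)).
- move=> u v t [Ku fu] [Kv fv] t0 t1.
  have [w Kw fw] := cvxK u v t Ku Kv t0 t1.
  exists w => [|i]; last exact: fw.
  by split=> //; apply: le_trans (fw _) _; nra.
- move=> v [Kv fv]; have [k] := fpos v Kv.
  by case: (unliftP ord0 k) => [j ->|->] fk; [exists j|move: fk fv; lra].
pose h v := \sum_k mu k * f (lift ord0 k) v.
have [||s [t [s0 t0 st stP]]] := @two_function_minimax K (f ord0) h.
- move=> u v t Ku Kv t0 t1.
  have [w Kw fw] := cvxK u v t Ku Kv t0 t1.
  exists w => // -[]; first exact: fw.
  rewrite /h !mulr_sumr -big_split/=; apply: ler_sum => k _.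
  by have := fw (lift ord0 k); have := mu0 k; nra.
- by move=> v Kv fv; apply: muP.
exists (fun k => if unlift ord0 k is Some j then t * mu j else s); split.
- by move=> k; case: unlift => [j|//]; rewrite mulr_ge0.
- rewrite big_ord_recl unlift_none.
  under eq_bigr do rewrite liftK.
  rewrite -mulr_sumr.
  have [s_gt0|s_le0] := ltP 0 s; first by have := ltW smu; nra.
  have t_gt0 : 0 < t by lra.
  by have := mulr_gt0 t_gt0 smu; lra.
- move=> v Kv; rewrite big_ord_recl unlift_none.
  under eq_bigr do rewrite liftK -mulrA.
  by rewrite -mulr_sumr; exact: stP.
Qed.

End Minimax.

(** * Measure-theoretic tools *)

Section MeasureTools.
Context {R : realType} {dX} {X : measurableType dX}.

Lemma sigma_finite_weight (mu : {sigma_finite_measure set X -> \bar R})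
    (eps : R) : 0 < eps ->
  exists v : X -> R, [/\ measurable_fun [set: X] v, forall x, 0 < v x,
    forall x, v x <= 1 & (\int[mu]_x (v x)%:E <= eps%:E)%E].
Proof.
move=> eps0; have [F TF /all_and2[mF muFoo]] := sigma_finiteT mu.
have mF1 n : (mu (F n) < +oo)%E := muFoo n.
pose e := Order.min eps 1.
have e0 : 0 < e by rewrite lt_min eps0 ltr01.
pose m n := fine (mu (F n)).
have m0 n : 0 <= m n by exact: fine_ge0.
have mE n : mu (F n) = (m n)%:E.
  by apply/esym/fineK; rewrite ge0_fin_numE ?measure_ge0 ?mF1.
(* both [c n] and [c n * m n] are at most [e / 2 ^ n.+1] *)
pose c n := e / (2 ^ n.+1)%:R / (1 + m n).
have D0 n : 0 < e / (2 ^ n.+1)%:R by rewrite divr_gt0// ltr0n expn_gt0.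
have c0 n : 0 < c n by rewrite divr_gt0//; have := m0 n; lra.
have cle n : c n <= e / (2 ^ n.+1)%:R.
  by rewrite ler_pdivrMr; [have := D0 n|]; have := m0 n; nra.
have cmle n : c n * m n <= e / (2 ^ n.+1)%:R.
  rewrite /c mulrAC ler_pdivrMr; last by have := m0 n; lra.
  by have := D0 n; have := m0 n; nra.
pose s n x := (c n * \1_(F n) x)%:E : \bar R.
have s0 n x : (0 <= s n x)%E by rewrite lee_fin mulr_ge0// ltW.
have ms n : measurable_fun [set: X] (s n).
  apply/measurable_EFinP; apply: measurable_funM => //.
pose S x := (\sum_(n <oo) s n x)%E.
have mS : measurable_fun [set: X] S by exact: ge0_emeasurable_sum.
have S0 x : (0 <= S x)%E by exact: nneseries_ge0.
have Sle x : (S x <= e%:E)%E.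
  apply: (@le_trans _ _ (\sum_(n <oo) (e / (2 ^ n.+1)%:R)%:E)%E).
    apply: lee_nneseries => // n _; rewrite lee_fin.
    apply: le_trans (cle n); apply: ler_piMr; first exact: ltW.
    by rewrite indicE lern1 leq_b1.
  by rewrite epsilon_trick0// ltW.
have Sfin x : S x \is a fin_num.
  by rewrite ge0_fin_numE// (le_lt_trans (Sle x))// ltry.
exists (fun x => fine (S x)); split.
- exact: measurableT_comp.
- move=> x; rewrite fine_gt0//; apply/andP; split; last first.
    by rewrite -ge0_fin_numE.
  have : [set: X] x by [].
  rewrite TF => -[n _ Fx].
  apply: (@lt_le_trans _ _ (s n x)).
    by rewrite lte_fin indicE mem_set// mulr1.
  rewrite /S (@nneseriesD1 _ _ n)//.
  by apply: leeDl; exact: nneseries_ge0.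
- move=> x; rewrite -lee_fin fineK//; apply: le_trans (Sle x) _.
  by rewrite lee_fin ge_min lexx orbT.
- under eq_integral do rewrite fineK//.
  rewrite integral_nneseries//.
  apply: (@le_trans _ _ (\sum_(n <oo) (e / (2 ^ n.+1)%:R)%:E)%E).
    apply: lee_nneseries => [n _ _|n _]; first exact: integral_ge0.
    rewrite /s; under eq_integral do rewrite EFinM.
    rewrite ge0_integralZl_EFin//; last 2 first.
    - exact/measurable_EFinP.
    - exact: ltW.
    by rewrite integral_indic// setIT; have := cmle n; rewrite -lee_fin EFinM -mE.
  apply: le_trans (epsilon_trick0 _ (ltW e0)) _.
  by rewrite lee_fin ge_min lexx.
Qed.

(** A Borel-Cantelli argument: the sum is integrable, hence finite almost
    everywhere. *)
Lemma ae_series_lty (mu : {measure set X -> \bar R}) (f : nat -> X -> R) :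
  (forall n, measurable_fun [set: X] (f n)) -> (forall n x, 0 <= f n x) ->
  (\sum_(n <oo) \int[mu]_x (f n x)%:E < +oo)%E ->
  {ae mu, forall x, (\sum_(n <oo) (f n x)%:E < +oo)%E}.
Proof.
move=> mf f0 fin.
have iS : mu.-integrable [set: X] (fun x => \sum_(n <oo) (f n x)%:E)%E.
  apply/integrableP; split.
    apply: ge0_emeasurable_sum => [n x _ _|n _]; first by rewrite lee_fin.
    exact/measurable_EFinP.
  rewrite (eq_integral (fun x => \sum_(n <oo) (f n x)%:E)%E) => [|x _].
    rewrite integral_nneseries// => [n|n x _]; last by rewrite lee_fin.
    exact/measurable_EFinP.
  by rewrite gee0_abs//; apply: nneseries_ge0 => n _ _; rewrite lee_fin.
have := integrable_ae measurableT iS; apply: filterS => x /(_ I).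
by rewrite ge0_fin_numE//; apply: nneseries_ge0 => n _ _; rewrite lee_fin.
Qed.

(** Fatou's lemma in the form in which every bound below passes to a limit. *)
Lemma fatou_le (mu : {measure set X -> \bar R}) (f : nat -> X -> R)
    (g : X -> \bar R) (C : \bar R) :
  (forall n, measurable_fun [set: X] (f n)) -> (forall n x, 0 <= f n x) ->
  measurable_fun [set: X] g -> (forall x, 0 <= g x)%E ->
  {ae mu, forall x, (g x <= limn_einf (fun n => (f n x)%:E))%E} ->
  (forall n, \int[mu]_x (f n x)%:E <= C)%E ->
  (\int[mu]_x g x <= C)%E.
Proof.
move=> mf f0 mg g0 gf fC.
have mfE n : measurable_fun [set: X] (fun x => (f n x)%:E).
  exact/measurable_EFinP.
have fE0 n x : (0 <= (f n x)%:E)%E by rewrite lee_fin.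
have einfE (u : nat -> \bar R) : limn_einf u = ereal_sup (range (einfs u)).
  by rewrite limn_einf_lim; apply/cvg_lim => //; exact: cvg_einfs_sup.
have fat := @fatou _ _ _ mu _ measurableT (fun n x => (f n x)%:E) mfE
  (fun n x _ => fE0 n x).
apply: le_trans (le_trans _ fat) _.
  apply: ae_ge0_le_integral => //.
  - move=> x _; rewrite einfE.
    apply: le_trans (ereal_sup_ubound (imageP _ (I : [set: nat] 0%N))).
    by apply: le_ereal_inf_tmp => _ [n _ <-].
  - apply: (eq_measurable_fun (fun x => - limn_esup (fun n => - (f n x)%:E))%E).
      by move=> x _; rewrite -limn_einfN; congr limn_einf; apply/funext => n /=;
        rewrite opprK.
    apply: measurableT_comp => //; apply: measurable_fun_limn_esup => n.
    exact: measurableT_comp.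
  - by apply: filterS gf => x gx _.
rewrite einfE; apply: ge_ereal_sup => _ [n _ <-].
apply: le_trans (ereal_inf_lbound _) (fC n).
by exists n => /=.
Qed.
End MeasureTools.

(** * Weighted geometric means and admissible weights *)

Section GeometricMean.
Context {R : realType} {J : finType} (theta : J -> R).

Lemma prod_powR_expR (t : J -> R) : (forall j, 0 < t j) ->
  \prod_j t j `^ theta j = expR (\sum_j theta j * ln (t j)).
Proof.
by move=> t0; rewrite expR_sum; apply: eq_bigr => j _; rewrite /powR gt_eqF.
Qed.

Lemma ln_concave (a b t : R) : 0 < a -> 0 < b -> 0 <= t -> t <= 1 ->
  t * ln a + (1 - t) * ln b <= ln (t * a + (1 - t) * b).
Proof.
move=> a0 b0 t0 t1.
by have := concave_ln (Itv01 t0 t1) a0 b0; rewrite !convRE.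
Qed.

Hypothesis theta_gt0 : forall j, 0 < theta j.

(** Superlevel sets of the geometric mean are convex because its logarithm is
    concave. *)
Lemma prod_powR_ge1_convex (u v : J -> R) (t : R) :
  (forall j, 0 < u j) -> (forall j, 0 < v j) -> 0 <= t -> t <= 1 ->
  1 <= \prod_j u j `^ theta j -> 1 <= \prod_j v j `^ theta j ->
  1 <= \prod_j (t * u j + (1 - t) * v j) `^ theta j.
Proof.
move=> u0 v0 t0 t1.
have w0 j : 0 < t * u j + (1 - t) * v j by have := u0 j; have := v0 j; nra.
have ge1E (s : R) : (1 <= expR s) = (0 <= s) by rewrite -expR0 ler_expR.
rewrite !prod_powR_expR// !ge1E => hu hv.
apply: (@le_trans _ _ (t * (\sum_j theta j * ln (u j)) +
                     (1 - t) * (\sum_j theta j * ln (v j)))); first by nra.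
rewrite !mulr_sumr -big_split; apply: ler_sum => j _ /=.
rewrite (mulrCA t) (mulrCA (1 - t)) -mulrDr.
apply: ler_wpM2l; first exact: ltW.
exact: ln_concave.
Qed.

Hypothesis theta_sum1 : \sum_j theta j = 1.

(** Raising the entries of [H] to a threshold [a `^ M] costs at most
    [a * (1 + \sum_j H j)]: if an entry lies below the threshold, its factor is
    at most [a] because [1 <= M * theta j], and the others are controlled by
    [1 + \sum_j H j]. *)
Lemma prod_powR_max_le (H : J -> R) (a M : R) :
  (forall j, 0 <= H j) -> 0 < a -> a <= 1 -> (forall j, 1 <= M * theta j) ->
  \prod_j (Order.max (H j) (a `^ M)) `^ theta j <=
  \prod_j H j `^ theta j + a * (1 + \sum_j H j).
Proof.
move=> H0 a0 a1 M1.
have S0 : 0 <= \sum_j H j by exact: sumr_ge0.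
have [below|above] := pselect (exists j, H j < a `^ M); last first.
  rewrite (eq_bigr (fun j => H j `^ theta j)) => [|j _].
    by rewrite lerDl mulr_ge0//; [exact: ltW|lra].
  rewrite max_l// leNgt; apply/negP => ?; apply: above; by exists j.
have [j Hj] := below.
apply: (@le_trans _ _ (a * (1 + \sum_j H j))); last first.
  by rewrite lerDr prodr_ge0// => i _; exact: powR_ge0.
rewrite (bigD1 j)//= max_r; last exact: ltW.
have M0 : 0 <= M.
  by have := M1 j; rewrite -ler_pdivrMr//; apply: le_trans; rewrite divr_ge0// ltW.
have w1 : a `^ M <= 1.
  have := ge0_ler_powR M0 _ _ a1; rewrite powR1; apply; rewrite nnegrE//.
  exact: ltW.
apply: ler_pM; first exact: powR_ge0.
- by apply: prodr_ge0 => i _; exact: powR_ge0.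
- by rewrite -powRrM; apply: ge1r_powR; rewrite // a0.
have S1 : 1 <= 1 + \sum_j H j by lra.
apply: (@le_trans _ _ (\prod_(i | i != j) (1 + \sum_j H j) `^ theta i)).
  apply: ler_prod => i _; rewrite powR_ge0/=.
  apply: ge0_ler_powR; rewrite ?nnegrE; first exact: ltW.
  - by rewrite le_max powR_ge0 orbT.
  - lra.
  rewrite ge_max; apply/andP; split; last lra.
  have Si : 0 <= \sum_(k | k != i) H k by exact: sumr_ge0.
  by rewrite (bigD1 i)//=; lra.
have D0 : 1 + \sum_j H j != 0 by rewrite gt_eqF//; lra.
rewrite -[X in _ <= X]powRr1; last lra.
have -> : \prod_(i | i != j) (1 + \sum_j H j) `^ theta i =
    (1 + \sum_j H j) `^ (\sum_(i | i != j) theta i).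
  apply/esym; apply: (big_morph (fun r => (1 + \sum_j H j) `^ r)).
    by move=> r s; rewrite powRD// D0 implybT.
  exact: powRr0.
apply: ler_powR => //; rewrite -theta_sum1 [X in _ <= X](bigD1 j)//=.
by have := theta_gt0 j; lra.
Qed.

End GeometricMean.

Section Admissible.
Context {R : realType} {dX} {X : measurableType dX} {J : finType}.
Context (mu : {sigma_finite_measure set X -> \bar R}) (theta : J -> R).
Hypothesis theta_gt0 : forall j, 0 < theta j.
Hypothesis theta_sum1 : \sum_j theta j = 1.

Definition admissible (phi : J -> X -> R) : Prop :=
  [/\ forall j, measurable_fun [set: X] (phi j), forall j x, 0 < phi j x &
      forall x, 1 <= \prod_j phi j x `^ theta j].

Lemma admissible_convex (phi psi : J -> X -> R) (t : R) :
  admissible phi -> admissible psi -> 0 <= t -> t <= 1 ->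
  admissible (fun j x => t * phi j x + (1 - t) * psi j x).
Proof.
move=> [mphi phi0 phi1] [mpsi psi0 psi1] t0 t1; split.
- by move=> j; apply: measurable_funD; exact: measurable_funM.
- by move=> j x; have := phi0 j x; have := psi0 j x; nra.
- by move=> x; apply: prod_powR_ge1_convex.
Qed.

Lemma measurable_prod_powR (G : J -> X -> R) :
  (forall j, measurable_fun [set: X] (G j)) ->
  measurable_fun [set: X] (fun x => \prod_j G j x `^ theta j).
Proof.
move=> mG; apply: measurable_prod => j _.
exact: (measurableT_comp (measurable_powR (theta j)) (mG j)).
Qed.

(** Lets one divide by the entries of [H], at an arbitrarily small cost in the
    integral of the geometric mean. *)
Lemma positive_majorant (H : J -> X -> R) (eps : R) : 0 < eps ->
  (forall j, measurable_fun [set: X] (H j)) -> (forall j x, 0 <= H j x) ->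
  exists G : J -> X -> R, [/\ forall j, measurable_fun [set: X] (G j),
    forall j x, 0 < G j x, forall j x, H j x <= G j x &
    (\int[mu]_x (\prod_j G j x `^ theta j)%:E <=
     \int[mu]_x (\prod_j H j x `^ theta j)%:E + eps%:E)%E].
Proof.
move=> eps0 mH H0.
(* the threshold [a `^ M] is chosen so that [prod_powR_max_le] loses exactly [v] *)
have [v [mv v0 v1 iv]] := sigma_finite_weight mu eps0.
pose S x := 1 + \sum_j H j x.
have S1 x : 1 <= S x by rewrite lerDl sumr_ge0.
pose a x := v x / S x.
have a0 x : 0 < a x by rewrite divr_gt0//; have := S1 x; lra.
have a1 x : a x <= 1.
  rewrite ler_pdivrMr; last by have := S1 x; lra.
  by rewrite mul1r; apply: le_trans (v1 x) (S1 x).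
(* [M] only has to dominate every [(theta j)^-1] *)
pose M := \sum_j (theta j)^-1.
have M1 j : 1 <= M * theta j.
  rewrite -ler_pdivrMr// div1r /M (bigD1 j)//= lerDl sumr_ge0// => i _.
  by rewrite invr_ge0 ltW.
have mS : measurable_fun [set: X] S.
  by apply: measurable_funD => //; exact: measurable_sum.
have ma : measurable_fun [set: X] a.
  apply: measurable_funM => //.
  apply: (eq_measurable_fun (fun x => S x `^ (-1))) => [x _|].
    by rewrite powR_inv1//; have := S1 x; lra.
  exact: (measurableT_comp (measurable_powR (-1)) mS).
pose G j x := Order.max (H j x) (a x `^ M).
have mG j : measurable_fun [set: X] (G j).
  apply: measurable_maxr => //.
  exact: (measurableT_comp (measurable_powR M) ma).
exists G; split => //.
- by move=> j x; rewrite lt_max powR_gt0 ?orbT.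
- by move=> j x; rewrite le_max lexx.
apply: (@le_trans _ _ (\int[mu]_x
    ((\prod_j H j x `^ theta j)%:E + (v x)%:E))%E).
  apply: ge0_le_integral => //.
  - by move=> x _; rewrite lee_fin prodr_ge0// => j _; exact: powR_ge0.
  - by apply/measurable_EFinP; exact: measurable_prod_powR.
  - apply: emeasurable_funD; apply/measurable_EFinP => //.
    exact: measurable_prod_powR.
  - move=> x _; rewrite -EFinD lee_fin.
    apply: le_trans (prod_powR_max_le theta_gt0 theta_sum1 (H0^~ x) (a0 x)
      (a1 x) M1) _.
    by rewrite lerD2l /a divfK// gt_eqF//; have := S1 x; rewrite /S; lra.
rewrite ge0_integralD//.
- by rewrite leeD2l.
- by move=> x _; rewrite lee_fin prodr_ge0// => j _; exact: powR_ge0.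
- by apply/measurable_EFinP; exact: measurable_prod_powR.
- by move=> x _; rewrite lee_fin ltW.
- exact/measurable_EFinP.
Qed.

End Admissible.

(** * Duality for finitely many constraints *)

(** A convex cone of pairs [(G, c)], to be read as: [G] has cost at most [c]. *)
Record costed_cone {R : realType} {dX} {X : measurableType dX}
    (A : (X -> R) -> R -> Prop) : Prop := CostedCone {
  cone_meas : forall G c, A G c -> measurable_fun [set: X] G;
  cone_ge0 : forall G c x, A G c -> 0 <= G x;
  cone_cost_ge0 : forall G c, A G c -> 0 <= c;
  cone0 : A (fun=> 0) 0;
  coneD : forall G c G' c', A G c -> A G' c' -> A (fun x => G x + G' x) (c + c');
  coneZ : forall s G c, 0 <= s -> A G c -> A (fun x => s * G x) (s * c) }.

Section Factorization.
Context {R : realType} {dX} {X : measurableType dX} {J : finType}.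
Context (mu : {sigma_finite_measure set X -> \bar R}) (theta : J -> R).
Hypothesis theta_gt0 : forall j, 0 < theta j.
Hypothesis theta_sum1 : \sum_j theta j = 1.
Context (A : J -> (X -> R) -> R -> Prop) (B : R).
Hypothesis coneA : forall j, costed_cone (A j).
Hypothesis B_ge0 : 0 <= B.
Hypothesis A_bound : forall (G : J -> X -> R) (c : J -> R),
  (forall j, A j (G j) (c j)) ->
  (\int[mu]_x (\prod_j G j x `^ theta j)%:E <=
   (B * \prod_j c j `^ theta j)%:E)%E.

Lemma cone_sum (j : J) (I : Type) (r : seq I) (P : pred I) (G : I -> X -> R)
    (c : I -> R) : (forall i, P i -> A j (G i) (c i)) ->
  A j (fun x => \sum_(i <- r | P i) G i x) (\sum_(i <- r | P i) c i).
Proof.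
move=> AG; elim: r => [|i r IH].
  by under eq_fun do rewrite big_nil; rewrite big_nil; exact: cone0.
under eq_fun do rewrite big_cons; rewrite big_cons.
by case: ifPn => // Pi; apply: coneD => //; exact: AG.
Qed.

Lemma integral_convex (G phi psi : X -> R) (t : R) :
  measurable_fun [set: X] G -> measurable_fun [set: X] phi ->
  measurable_fun [set: X] psi -> (forall x, 0 <= G x) ->
  (forall x, 0 <= phi x) -> (forall x, 0 <= psi x) -> 0 <= t -> t <= 1 ->
  (\int[mu]_x (G x * (t * phi x + (1 - t) * psi x))%:E =
   t%:E * \int[mu]_x (G x * phi x)%:E +
   (1 - t)%:E * \int[mu]_x (G x * psi x)%:E)%E.
Proof.
move=> mG mphi mpsi G0 phi0 psi0 t0 t1.
have t10 : 0 <= 1 - t by lra.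
have mGf f : measurable_fun [set: X] f ->
    measurable_fun [set: X] (fun x => (G x * f x)%:E).
  by move=> mf; apply/measurable_EFinP; exact: measurable_funM.
have Gf0 f : (forall x, 0 <= f x) -> forall x, [set: X] x ->
    (0 <= (G x * f x)%:E)%E.
  by move=> f0 x _; rewrite lee_fin mulr_ge0.
rewrite (eq_integral (fun x =>
    t%:E * (G x * phi x)%:E + (1 - t)%:E * (G x * psi x)%:E)%E); last first.
  by move=> x _; rewrite -!EFinM -EFinD; congr EFin; ring.
rewrite ge0_integralD//.
- rewrite ge0_integralZl_EFin//; [|exact: Gf0|exact: mGf].
  by rewrite ge0_integralZl_EFin//; [exact: Gf0|exact: mGf].
- by move=> x _; rewrite mule_ge0// ?lee_fin// mulr_ge0.
- by apply: measurable_funeM; exact: mGf.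
- by move=> x _; rewrite mule_ge0// ?lee_fin// mulr_ge0.
- by apply: measurable_funeM; exact: mGf.
Qed.

(** If no weight satisfied all the constraints, the minimax theorem would merge
    them into one violated constraint for each [j], and the weights that equalize
    the integrals in the geometric mean bound would contradict it. The slack
    [delta] absorbs the perturbations: [eta] makes every multiplier positive, so
    that each constraint is controlled, and [positive_majorant] makes every
    denominator positive. *)
Lemma finite_factorization (n : nat) (k : 'I_n.+1 -> J) (G : 'I_n.+1 -> X -> R)
    (c : 'I_n.+1 -> R) (delta : R) : 0 < delta ->
  (forall i, A (k i) (G i) (c i)) ->
  exists2 phi : J -> X -> R, admissible theta phi &
    forall i, (\int[mu]_x (G i x * phi (k i) x)%:E <=
               ((B + delta) * (c i + delta))%:E)%E.
Proof.
move=> d0 AG; apply: contrapT => no_phi.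
have Bd0 : 0 < B + delta by rewrite ltr_wpDl.
have mG i : measurable_fun [set: X] (G i) := cone_meas (coneA _) (AG i).
have G0 i x : 0 <= G i x := cone_ge0 (coneA _) x (AG i).
have c0 i : 0 <= c i := cone_cost_ge0 (coneA _) (AG i).
pose Int i (phi : J -> X -> R) := (\int[mu]_x (G i x * phi (k i) x)%:E)%E.
have Int0 i phi : admissible theta phi -> (0 <= Int i phi)%E.
  move=> [_ phi0 _]; apply: integral_ge0 => x _.
  by rewrite lee_fin mulr_ge0// ltW.
pose K : set (J -> X -> R) :=
  [set phi | admissible theta phi /\ forall i, (Int i phi < +oo)%E].
have IntE i phi : K phi -> Int i phi = (fine (Int i phi))%:E.
  by move=> [aphi fin]; rewrite fineK// ge0_fin_numE// Int0.
pose f i phi := fine (Int i phi) - (B + delta) * (c i + delta).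
have [||lam [lam0 slam lamP]] := @convexlike_minimax R _ n K f.
- move=> phi psi t Kphi Kpsi t0 t1.
  have [mphi phi0 _] := Kphi.1; have [mpsi psi0 _] := Kpsi.1.
  pose chi j x := t * phi j x + (1 - t) * psi j x.
  have E i : Int i chi = (t * fine (Int i phi) + (1 - t) * fine (Int i psi))%:E.
    rewrite /Int /chi integral_convex//; last 2 first.
    - by move=> x; exact: ltW.
    - by move=> x; exact: ltW.
    by rewrite -/(Int i phi) -/(Int i psi) (IntE i phi)// (IntE i psi)// -!EFinM.
  exists chi => [|i].
    split; first by apply: admissible_convex => //; [exact: Kphi.1|exact: Kpsi.1].
    by move=> i; rewrite E ltry.
  by rewrite /f E/=; lra.
- move=> phi Kphi; apply: contrapT => /forallNP none; apply: no_phi.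
  exists phi; first exact: Kphi.1.
  move=> i; rewrite -/(Int i phi) IntE// lee_fin.
  by have := none i; rewrite /f => /negP; rewrite -leNgt; lra.
set L := \sum_i lam i in slam.
pose Sc := \sum_i c i.
have Sc0 : 0 <= Sc by exact: sumr_ge0.
pose D := Sc + #|J|%:R + 1.
have D0 : 0 < D by rewrite /D; have := ler0n R #|J|; lra.
(* small enough for the total cost to grow by less than [delta * L] *)
pose eta := delta * L / D.
have eta0 : 0 < eta by rewrite divr_gt0// mulr_gt0.
pose H j x := \sum_(i | k i == j) (lam i + eta) * G i x.
pose C j := \sum_(i | k i == j) (lam i + eta) * c i.
have le0 i : 0 < lam i + eta by have := lam0 i; lra.
have AH j : A j (H j) (C j).
  apply: cone_sum => i /eqP <-; apply: coneZ => //; exact: ltW.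
have C0 j : 0 <= C j := cone_cost_ge0 (coneA j) (AH j).
pose N j := C j + eta.
have N0 j : 0 < N j by have := C0 j; rewrite /N; lra.
pose P := \prod_j N j `^ theta j.
have P0 : 0 < P by apply: prodr_gt0 => j _; exact: powR_gt0.
have mH j : measurable_fun [set: X] (H j) := cone_meas (coneA j) (AH j).
have H0 j x : 0 <= H j x := cone_ge0 (coneA j) x (AH j).
have [G' [mG' G'0 HG' iG']] :=
  positive_majorant mu theta_gt0 theta_sum1 (mulr_gt0 d0 P0) mH H0.
pose Q x := \prod_j G' j x `^ theta j.
have Q0 x : 0 < Q x by apply: prodr_gt0 => j _; exact: powR_gt0.
have mQ : measurable_fun [set: X] Q by exact: measurable_prod_powR.
have iQ : (\int[mu]_x (Q x)%:E <= ((B + delta) * P)%:E)%E.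
  apply: le_trans iG' _; rewrite mulrDl EFinD leeD2r//.
  apply: le_trans (A_bound AH) _; rewrite lee_fin ler_wpM2l//.
  apply: ler_prod => j _; rewrite powR_ge0/=.
  apply: ge0_ler_powR; rewrite ?nnegrE//; first exact: ltW.
    exact: ltW.
  by rewrite /N; lra.
(* equality case of the inequality between means: [G' j * phi j / N j] does not
   depend on [j] *)
pose phi j x := N j / P * (Q x / G' j x).
have phi0 j x : 0 < phi j x by rewrite mulr_gt0 ?divr_gt0.
have aphi : admissible theta phi.
  split => //.
  - move=> j; apply: measurable_funM => //; apply: measurable_funM => //.
    apply: (eq_measurable_fun (fun x => G' j x `^ (-1))) => [x _|].
      by rewrite powR_inv1// ltW.
    exact: (measurableT_comp (measurable_powR (-1)) (mG' j)).
  - move=> x; rewrite prod_powR_expR// (_ : \sum_j _ = 0) ?expR0//.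
    have lnphi j : ln (phi j x) = ln (N j) - ln P + (ln (Q x) - ln (G' j x)).
      by rewrite /phi lnM ?posrE ?divr_gt0// ln_div ?posrE// ln_div ?posrE.
    under eq_bigr do rewrite lnphi.
    have lnP : ln P = \sum_j theta j * ln (N j).
      by rewrite /P prod_powR_expR// expRK.
    have lnQ : ln (Q x) = \sum_j theta j * ln (G' j x).
      by rewrite /Q prod_powR_expR// expRK.
    under eq_bigr do rewrite mulrDr !mulrBr.
    rewrite big_split/= 2!sumrB -2!mulr_suml theta_sum1 !mul1r -lnP -lnQ.
    by lra.
have mphi j : measurable_fun [set: X] (phi j) by case: aphi.
have iG'phi j : (\int[mu]_x (G' j x * phi j x)%:E <= ((B + delta) * N j)%:E)%E.
  have E x : G' j x * phi j x = N j / P * Q x.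
    by rewrite /phi; field; rewrite !gt_eqF.
  under eq_integral do rewrite E EFinM.
  have NP0 : 0 <= N j / P by rewrite divr_ge0// ltW.
  rewrite ge0_integralZl_EFin//; last 2 first.
  - by move=> x _; rewrite lee_fin ltW.
  - exact/measurable_EFinP.
  apply: (@le_trans _ _ ((N j / P)%:E * ((B + delta) * P)%:E)%E).
    by apply: lee_wpmul2l; rewrite ?lee_fin.
  by rewrite -EFinM lee_fin le_eqVlt; apply/orP; left; apply/eqP; field;
    rewrite gt_eqF.
have iHphi j : (\int[mu]_x (H j x * phi j x)%:E <= ((B + delta) * N j)%:E)%E.
  apply: le_trans (iG'phi j); apply: ge0_le_integral => //.
  - by move=> x _; rewrite lee_fin mulr_ge0// ltW.
  - by apply/measurable_EFinP; exact: measurable_funM.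
  - by apply/measurable_EFinP; exact: measurable_funM.
  - by move=> x _; rewrite lee_fin ler_wpM2r// ltW.
have HphiE j : (\int[mu]_x (H j x * phi j x)%:E =
    \sum_(i | k i == j) (lam i + eta)%:E * Int i phi)%E.
  rewrite (eq_integral (fun x => \sum_(i <- [seq i <- index_enum 'I_n.+1 |
      k i == j]) ((lam i + eta) * G i x * phi j x)%:E)%E); last first.
    by move=> x _; rewrite /H mulr_suml -sumEFin big_filter.
  rewrite ge0_integral_sum//.
  - rewrite big_filter; apply: eq_bigr => i /eqP kij.
    under eq_integral do rewrite -mulrA EFinM.
    rewrite ge0_integralZl_EFin ?kij//.
    + by rewrite /Int kij.
    + by move=> x _; rewrite lee_fin mulr_ge0// ltW.
    + by apply/measurable_EFinP; exact: measurable_funM.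
    + exact: ltW.
  - move=> i; apply/measurable_EFinP; apply: measurable_funM => //.
    exact: measurable_funM.
  - move=> i x _; rewrite lee_fin mulr_ge0//; last exact: ltW.
    by rewrite mulr_ge0// ltW.
have Kphi : K phi.
  split => // i.
  have : ((lam i + eta)%:E * Int i phi <= ((B + delta) * N (k i))%:E)%E.
    apply: le_trans (iHphi (k i)); rewrite HphiE (bigD1 i)//= leeDl// sume_ge0//.
    by move=> i' _; rewrite mule_ge0// ?lee_fin ?Int0// ltW.
  have := Int0 i phi aphi; case: (Int i phi) => [r|_|//]; first by rewrite ltry.
  by rewrite gt0_muley ?lte_fin// leye_eq.
have sumInt : \sum_i (lam i + eta) * fine (Int i phi) <= (B + delta) * \sum_j N j.
  rewrite (partition_big k xpredT)//= mulr_sumr; apply: ler_sum => j _.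
  rewrite -lee_fin -sumEFin; apply: le_trans (iHphi j); rewrite HphiE.
  by apply: lee_sum => i _; rewrite EFinM -IntE.
have sumC : \sum_j C j = \sum_i lam i * c i + eta * Sc.
  transitivity (\sum_i (lam i + eta) * c i).
    by rewrite [RHS](partition_big k xpredT).
  by rewrite mulr_sumr -big_split; apply: eq_bigr => i _ /=; rewrite mulrDl.
have sumN : \sum_j N j = \sum_i lam i * c i + eta * (Sc + #|J|%:R).
  by rewrite /N big_split/= sumC sumr_const mulrDr addrA mulr_natr.
have := lamP phi Kphi.
have lamfE i : lam i * f i phi =
    lam i * fine (Int i phi) - (B + delta) * (lam i * c i + lam i * delta).
  by rewrite /f; ring.
under eq_bigr do rewrite lamfE.
have eD : eta * (Sc + #|J|%:R) < delta * L.
  have <- : eta * D = delta * L by rewrite /eta divfK// gt_eqF.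
  by rewrite ltr_pM2l// /D; lra.
rewrite sumrB -mulr_sumr big_split/= -mulr_suml.
have : \sum_i lam i * fine (Int i phi) <= \sum_i (lam i + eta) * fine (Int i phi).
  apply: ler_sum => i _; rewrite ler_wpM2r//; last lra.
  by apply: fine_ge0; exact: Int0.
rewrite -/L => h1 h2.
have : (B + delta) * \sum_j N j < (B + delta) * (\sum_i lam i * c i + L * delta).
  by rewrite ltr_pM2l// sumN; lra.
by lra.
Qed.

End Factorization.

(** * Compactness of directed families of convex sets *)

Section DirectedCompactness.
Context {R : realType} {dX} {X : measurableType dX} {J : finType}.
Context (mu : {sigma_finite_measure set X -> \bar R}).

(** Extends to a homeomorphism from [[0, +oo]] to [[0, 1]]; its square is the strictly
    convex function [exp (- phi)]. *)
Definition exp_half (phi : J -> X -> R) (j : J) (x : X) : R :=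
  expR (- (phi j x / 2)).

Lemma exp_half_ge0 phi j x : 0 <= exp_half phi j x.
Proof. exact: expR_ge0. Qed.

Lemma exp_half_le1 (phi : J -> X -> R) j x :
  0 <= phi j x -> exp_half phi j x <= 1.
Proof. by move=> phi0; rewrite -expR0 ler_expR oppr_le0 divr_ge0. Qed.

Lemma measurable_exp_half (phi : J -> X -> R) j :
  measurable_fun [set: X] (phi j) -> measurable_fun [set: X] (exp_half phi j).
Proof.
move=> mphi.
rewrite (_ : exp_half phi j = expR \o (fun x => - (phi j x / 2)))//.
apply: measurableT_comp => //.
by apply: measurableT_comp => //; exact: measurable_funM.
Qed.

Lemma cvg_of_summable_increments (u : nat -> R) :
  cvgn (series (fun n => `|u n.+1 - u n|)) -> cvgn u.
Proof.
move=> cu.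
have cs := @normed_cvg _ _ (telescope u) cu.
have -> : u = (fun n => u 0%N + series (telescope u) n).
  by apply/funext => n; exact: eq_sum_telescope.
by apply: is_cvgD; [exact: is_cvg_cst|exact: cs].
Qed.

Context (w : X -> R).
Hypothesis mw : measurable_fun [set: X] w.
Hypothesis w_gt0 : forall x, 0 < w x.
Hypothesis w_int : (\int[mu]_x (w x)%:E <= 1)%E.

Let good (phi : J -> X -> R) :=
  (forall j, measurable_fun [set: X] (phi j)) /\ (forall j x, 0 <= phi j x).

Let dist (phi psi : J -> X -> R) : \bar R :=
  (\int[mu]_x (w x * \sum_j (exp_half phi j x - exp_half psi j x) ^+ 2)%:E)%E.

Let energy (phi : J -> X -> R) : \bar R :=
  (\int[mu]_x (w x * \sum_j (exp_half phi j x) ^+ 2)%:E)%E.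

Let mid (phi psi : J -> X -> R) : J -> X -> R :=
  fun j x => (phi j x + psi j x) / 2.

Let measurable_sq (f : J -> X -> R) :
  (forall j, measurable_fun [set: X] (f j)) ->
  measurable_fun [set: X] (fun x => (w x * \sum_j (f j x) ^+ 2)%:E).
Proof.
move=> mf; apply/measurable_EFinP; apply: measurable_funM => //.
by apply: measurable_sum => j; apply: measurable_funX.
Qed.

Let sq_ge0 (f : J -> X -> R) x : (0 <= (w x * \sum_j (f j x) ^+ 2)%:E)%E.
Proof.
rewrite lee_fin mulr_ge0//; first exact: ltW.
by apply: sumr_ge0 => j _; exact: sqr_ge0.
Qed.

Let good_mid phi psi : good phi -> good psi -> good (mid phi psi).
Proof.
move=> [mphi phi0] [mpsi psi0]; split=> [j|j x].
  by apply: measurable_funM => //; exact: measurable_funD.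
by rewrite divr_ge0// addr_ge0.
Qed.

Let energy_le phi : good phi -> (energy phi <= #|J|%:R%:E)%E.
Proof.
move=> [mphi phi0].
apply: (@le_trans _ _ (\int[mu]_x (#|J|%:R%:E * (w x)%:E))%E).
  apply: ge0_le_integral => //.
  - by apply: measurable_sq => j; exact: measurable_exp_half.
  - by apply: measurable_funeM; exact/measurable_EFinP.
  - move=> x _; rewrite -EFinM lee_fin mulrC; apply: ler_wpM2r.
      exact: ltW.
    rewrite -sumr_const; apply: ler_sum => j _.
    by rewrite expr_le1// ?exp_half_le1// exp_half_ge0.
rewrite ge0_integralZl_EFin//.
- by rewrite -[leRHS]mule1; apply: lee_wpmul2l; rewrite ?lee_fin.
- by move=> x _; rewrite lee_fin ltW.
- exact/measurable_EFinP.
Qed.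

Let energy_ge0 phi : (0 <= energy phi)%E.
Proof. by apply: integral_ge0 => x _; exact: sq_ge0. Qed.

Let energyE phi : good phi -> energy phi = (fine (energy phi))%:E.
Proof.
move=> gphi; rewrite fineK// ge0_fin_numE//.
by apply: le_lt_trans (energy_le gphi) _; rewrite ltry.
Qed.

(** The parallelogram law: the product of the square roots of [exp (- phi)] and
    [exp (- psi)] is [exp] of minus the midpoint. *)
Let parallelogram phi psi : good phi -> good psi ->
  (dist phi psi + 2%:E * energy (mid phi psi) = energy phi + energy psi)%E.
Proof.
move=> gphi gpsi; have [mphi _] := gphi; have [mpsi _] := gpsi.
have [mmid _] := good_mid gphi gpsi.
have me f : (forall j, measurable_fun [set: X] (f j)) ->
    measurable_fun [set: X] (fun x => (w x * \sum_j exp_half f j x ^+ 2)%:E).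
  by move=> mf; apply: measurable_sq => j; exact: measurable_exp_half.
rewrite -ge0_integralZl_EFin//; last exact: me.
rewrite -ge0_integralD//; last 4 first.
- move=> x _.
  exact: (sq_ge0 (fun j x => exp_half phi j x - exp_half psi j x)).
- apply: measurable_sq => j; apply: measurable_funB; exact: measurable_exp_half.
- by move=> x _; rewrite mule_ge0.
- by apply: measurable_funeM; exact: me.
rewrite -ge0_integralD//; [|exact: me|exact: me].
apply: eq_integral => x _; rewrite -EFinM -!EFinD; congr EFin.
rewrite mulrCA -!mulrDr; congr (_ * _).
rewrite mulr_sumr -!big_split; apply: eq_bigr => j _ /=.
have -> : exp_half (mid phi psi) j x ^+ 2 = exp_half phi j x * exp_half psi j x.
  by rewrite expr2 -!expRD; congr expR; rewrite /mid; field.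
by ring.
Qed.

(** Closeness at a geometric rate forces summable increments almost everywhere,
    through [|d| <= 2^-n + 2^n * d^2]. *)
Let summable_of_dist (phi psi : nat -> J -> X -> R) :
  (forall n, good (phi n)) -> (forall n, good (psi n)) ->
  (forall n, dist (phi n) (psi n) <= (4 / 4 ^+ n)%:E)%E ->
  {ae mu, forall x j, cvgn (series (fun n =>
    `|exp_half (phi n) j x - exp_half (psi n) j x|))}.
Proof.
move=> gphi gpsi dle.
pose d n j x := exp_half (phi n) j x - exp_half (psi n) j x.
pose f n x := 2 ^+ n * (w x * \sum_j (d n j x) ^+ 2).
have md n j : measurable_fun [set: X] (d n j).
  have [mphi _] := gphi n; have [mpsi _] := gpsi n.
  by apply: measurable_funB; exact: measurable_exp_half.
have mf n : measurable_fun [set: X] (f n).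
  by apply: measurable_funM => //; apply/measurable_EFinP; exact: measurable_sq.
have f0 n x : 0 <= f n x.
  by apply: mulr_ge0; [exact: exprn_ge0|rewrite -lee_fin; exact: sq_ge0].
have sumf : (\sum_(n <oo) \int[mu]_x (f n x)%:E < +oo)%E.
  apply: (@le_lt_trans _ _ (\sum_(n <oo) (8 / (2 ^ n.+1)%:R)%:E)%E).
    apply: lee_nneseries => [n _ _|n _].
      by apply: integral_ge0 => x _; rewrite lee_fin.
    under eq_integral do rewrite EFinM.
    rewrite ge0_integralZl_EFin//; [|exact: measurable_sq].
    apply: (@le_trans _ _ ((2 ^+ n)%:E * (4 / 4 ^+ n)%:E)%E).
      by apply: lee_wpmul2l; [rewrite lee_fin|exact: dle].
    rewrite -EFinM lee_fin natrX exprS (_ : 4 ^+ n = 2 ^+ n * 2 ^+ n :> R).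
      by rewrite le_eqVlt; apply/orP; left; apply/eqP; field; rewrite expf_neq0.
    by rewrite -exprMn; congr (_ ^+ _); lra.
  by apply: le_lt_trans (epsilon_trick0 _ _) _; rewrite ?ltry.
have := ae_series_lty mf f0 sumf; apply: filterS => x fx j.
set S := (\sum_(n <oo) (f n x)%:E)%E in fx.
have S0 : (0 <= S)%E by apply: nneseries_ge0 => n _ _; rewrite lee_fin.
have SE : S = (fine S)%:E by rewrite fineK// ge0_fin_numE.
apply: nondecreasing_is_cvgn.
  by apply/nondecreasing_seqP => n; rewrite seriesSr lerDl.
exists (2 + fine S / w x) => _ [n _ <-].
have dle1 k : `|d k j x| <= 2^-1 ^+ k + f k x / w x.
  have wx := w_gt0 x.
  have -> : f k x / w x = 2 ^+ k * \sum_i d k i x ^+ 2.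
    by rewrite /f; field; rewrite gt_eqF.
  have le_sum : d k j x ^+ 2 <= \sum_i d k i x ^+ 2.
    by rewrite (bigD1 j)//= lerDl sumr_ge0// => i _; exact: sqr_ge0.
  have pk : 0 < 2 ^+ k :> R by exact: exprn_gt0.
  rewrite exprVn; set P := 2 ^+ k in pk *.
  apply: (@le_trans _ _ (P^-1 + P * d k j x ^+ 2)); last first.
    by rewrite lerD2l ler_pM2l.
  have := sqr_ge0 (1 - P * `|d k j x|).
  have : 0 <= `|d k j x| by [].
  rewrite -(real_normK (num_real (d k j x))).
  set a := `|d k j x| => a0 sq.
  rewrite -(ler_pM2l pk) mulrDr mulfV ?gt_eqF//.
  by rewrite expr2 in sq *; have := mulr_ge0 (ltW pk) a0; lra.
apply: (@le_trans _ _ (\sum_(k < n) (2^-1 ^+ k + f k x / w x))).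
  by rewrite /series/= big_mkord; apply: ler_sum => k _; exact: dle1.
rewrite big_split/= -mulr_suml lerD//.
  have := @geometric_le_lim R n 1 2^-1; rewrite ger0_norm// -exprn_geometric.
  by rewrite /series/= big_mkord (_ : 1 / (1 - 2^-1) = 2); [apply; lra|field].
rewrite ler_pM2r ?invr_gt0// -lee_fin -SE -sumEFin.
have := @nneseries_lim_ge R (fun k => (f k x)%:E) xpredT 0 n.
by rewrite big_mkord; apply => k _ _; rewrite lee_fin.
Qed.


(** Let [s] be the supremum over [a] of the infimum of the energy on [K a]. The sets
    [Near n] of elements of some [K (alpha n)] whose energy is within [eps n] of [s]
    have small diameter by the parallelogram law, and they meet every [K a] by
    directedness; so any choice of elements in [Near n] converges, and always to
    the same limit. *)
Lemma directed_compactness_weighted {I : Type} (K : I -> set (J -> X -> R))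
    (a0 : I) :
  (forall a phi, K a phi ->
    (forall j, measurable_fun [set: X] (phi j)) /\ (forall j x, 0 <= phi j x)) ->
  (forall a phi psi, K a phi -> K a psi ->
    K a (fun j x => (phi j x + psi j x) / 2)) ->
  (forall a, K a !=set0) ->
  (forall a b, exists c, K c `<=` K a `&` K b) ->
  exists2 u : J -> X -> R, forall j, measurable_fun [set: X] (u j) &
    forall a, exists2 phi : nat -> J -> X -> R, forall n, K a (phi n) &
      {ae mu, forall x j, exp_half (phi n) j x @[n --> \oo] --> u j x}.
Proof.
move=> Kgood Kmid Kne Kdir.
pose E phi := fine (energy phi).
have EE phi : good phi -> energy phi = (E phi)%:E := @energyE phi.
pose S := [set r | exists a, forall phi, K a phi -> r <= E phi].
have S0 : S 0 by exists a0 => phi _; exact: fine_ge0.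
have ubS : ubound S #|J|%:R.
  move=> r [a ra]; have [phi Kphi] := Kne a; apply: le_trans (ra _ Kphi) _.
  by rewrite -lee_fin -energyE ?energy_le//; exact: Kgood Kphi.
have supS : has_sup S by split; [exists 0|exists #|J|%:R].
pose s := sup S.
have low e : 0 < e -> exists a, forall phi, K a phi -> s - e <= E phi.
  move=> e0; have [r [a ra] sr] := sup_adherent e0 supS.
  by exists a => phi /ra; apply: le_trans; exact: ltW.
have near_inf e a : 0 < e -> exists2 phi, K a phi & E phi <= s + e.
  move=> e0; apply: contrapT => none.
  have : S (s + e).
    exists a => phi Kphi; rewrite leNgt; apply/negP => lt_s; apply: none.
    by exists phi => //; exact: ltW.
  by have := ub_le_sup supS.2; move=> /[apply]; rewrite -/s; lra.
pose eps n : R := 1 / 4 ^+ n.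
have eps0 n : 0 < eps n by rewrite divr_gt0// exprn_gt0.
have [alpha alphaP] := choice (fun n => low (eps n) (eps0 n)).
pose Near n phi := K (alpha n) phi /\ E phi <= s + eps n.
have close n phi psi : Near n phi -> Near n psi ->
    (dist phi psi <= (4 / 4 ^+ n)%:E)%E.
  move=> [Kphi Ephi] [Kpsi Epsi].
  have gphi := Kgood _ _ Kphi; have gpsi := Kgood _ _ Kpsi.
  have gmid := good_mid gphi gpsi.
  have := parallelogram gphi gpsi.
  rewrite (EE _ gphi) (EE _ gpsi) (EE _ gmid).
  have Emid : s - eps n <= E (mid phi psi) := alphaP n _ (Kmid _ _ _ Kphi Kpsi).
  rewrite -EFinM -EFinD; case: (dist phi psi) => [r|//|//].
  rewrite -EFinD => -[rE]; rewrite lee_fin.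
  have -> : 4 / 4 ^+ n = 4 * eps n by rewrite /eps mul1r.
  move: (E phi) (E psi) (E (mid phi psi)) rE Emid Ephi Epsi.
  move=> e1 e2 e3 rE Emid Ephi Epsi.
  by clear -rE Emid Ephi Epsi; lra.
have meet n a : exists phi, Near n phi /\ K a phi.
  have [b Kb] := Kdir (alpha n) a.
  have [phi Kphi Ephi] := near_inf (eps n) b (eps0 n).
  by have [? ?] := Kb _ Kphi; exists phi.
have epsS n : eps n.+1 <= eps n.
  by rewrite ler_pM2l// lef_pV2 ?posrE ?exprn_gt0// ler_weXn2l// ler1n.
have [phi phiP] := choice (fun n => meet n a0).
have phiN n : Near n (phi n) by have [] := phiP n.
(* [psi n] is close both to [phi n] and to [phi n.+1] *)
have [psi psiP] := choice (fun n => meet n.+1 (alpha n)).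
have psiN n : Near n.+1 (psi n) by have [] := psiP n.
have psiN' n : Near n (psi n).
  have [[_ Epsi] Kpsi] := psiP n.
  by split => //; apply: le_trans Epsi _; rewrite lerD2l.
have gNear n f : Near n f -> good f by move=> [/Kgood].
have gphi n : good (phi n) := gNear _ _ (phiN n).
have gpsi n : good (psi n) := gNear _ _ (psiN n).
have cvg1 := summable_of_dist gphi gpsi (fun n => close n _ _ (phiN n) (psiN' n)).
have dist2 n : (dist (phi n.+1) (psi n) <= (4 / 4 ^+ n)%:E)%E.
  apply: le_trans (close n.+1 _ _ (phiN n.+1) (psiN n)) _.
  by have := epsS n; rewrite lee_fin /eps !mul1r => h; rewrite ler_pM2l.
have cvg2 := summable_of_dist (fun n => gphi n.+1) gpsi dist2.
pose v n j x := exp_half (phi n) j x.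
have cv : {ae mu, forall x j, cvgn (fun n => v n j x)}.
  apply: filterS2 cvg1 cvg2 => x c1x c2x j; have c1 := c1x j; have c2 := c2x j.
  apply: cvg_of_summable_increments.
  apply: (series_le_cvg _ _ _ (is_cvg_seriesD c2 c1)) => // n; rewrite /=.
    by rewrite addr_ge0.
  rewrite -[X in `|X|](subrKA (exp_half (psi n) j x)).
  rewrite [X in _ <= _ + X]distrC.
  exact: ler_normD.
have v01 n j x : 0 <= v n j x /\ v n j x <= 1.
  by have [_ phi0] := gphi n; rewrite exp_half_ge0 exp_half_le1.
exists (fun j x => limn_sup (fun n => v n j x : R^o)).
  move=> j; apply: measurable_fun_limn_sup.
  - by move=> x _; exists 1 => _ [n _ <-]; have [] := v01 n j x.
  - by move=> x _; exists 0 => _ [n _ <-]; have [] := v01 n j x.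
  - by move=> n; have [mphi _] := gphi n; exact: measurable_exp_half.
move=> a; have [chi chiP] := choice (fun n => meet n a).
exists chi => [n|]; first by have [] := chiP n.
have chiN n : Near n (chi n) by have [] := chiP n.
have gchi n : good (chi n) := gNear _ _ (chiN n).
have cvg3 := summable_of_dist gchi gphi (fun n => close n _ _ (chiN n) (phiN n)).
apply: filterS2 cv cvg3 => x cvx c3x j.
have vx : cvgn (fun n => v n j x) := cvx j.
have c3 : cvgn (series (fun n => `|exp_half (chi n) j x - v n j x|)) := c3x j.
have d0 : (fun n => exp_half (chi n) j x - v n j x) @ \oo --> 0.
  by apply/norm_cvg0P; exact: cvg_series_cvg_0.
rewrite (cvg_limn_supE (u := fun n => v n j x : R^o))//.
rewrite -[X in _ --> X]add0r.
rewrite (_ : (fun n => exp_half (chi n) j x) =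
  (fun n => (exp_half (chi n) j x - v n j x) + v n j x)).
  exact: cvgD.
by apply/funext => n; rewrite subrK.
Qed.

End DirectedCompactness.

(** A substitute for weak compactness in spaces of nonnegative functions, where no
    countability of the index set is available. *)
Lemma directed_compactness {R : realType} {dX} {X : measurableType dX}
    {J : finType} (mu : {sigma_finite_measure set X -> \bar R}) {I : Type}
    (K : I -> set (J -> X -> R)) (a0 : I) :
  (forall a phi, K a phi ->
    (forall j, measurable_fun [set: X] (phi j)) /\ (forall j x, 0 <= phi j x)) ->
  (forall a phi psi, K a phi -> K a psi ->
    K a (fun j x => (phi j x + psi j x) / 2)) ->
  (forall a, K a !=set0) ->
  (forall a b, exists c, K c `<=` K a `&` K b) ->
  exists2 u : J -> X -> R, forall j, measurable_fun [set: X] (u j) &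
    forall a, exists2 phi : nat -> J -> X -> R, forall n, K a (phi n) &
      {ae mu, forall x j, exp_half (phi n) j x @[n --> \oo] --> u j x}.
Proof.
have [w [mw w0 _ iw]] := sigma_finite_weight mu (@ltr01 R).
exact: (directed_compactness_weighted mw w0 iw).
Qed.

(** * Duality for convex cones *)

Section ConeFactorization.
Context {R : realType} {dX} {X : measurableType dX} {J : finType}.
Context (mu : {sigma_finite_measure set X -> \bar R}) (theta : J -> R).

Lemma cvg_powR (t : nat -> R) (l r : R) : 0 < r -> (forall n, 0 < t n) ->
  t @ \oo --> l -> (fun n => t n `^ r) @ \oo --> l `^ r.
Proof.
move=> r0 t0 tl.
have l0 : 0 <= l.
  rewrite -(cvg_lim _ tl)//; apply: limr_ge; first by apply/cvg_ex; exists l.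
  by apply: nearW => n; exact: ltW.
move: l0; rewrite le_eqVlt => /predU1P[l0|l0].
  subst l; rewrite powR0 ?gt_eqF//.
  apply/cvgrPdist_lt => e e0.
  have e'0 : 0 < e `^ r^-1 by exact: powR_gt0.
  move/cvgrPdist_lt : tl => /(_ _ e'0); apply: filterS => n.
  rewrite !sub0r !normrN (gtr0_norm (t0 n)) gtr0_norm ?powR_gt0// => tn.
  rewrite -[X in _ < X]powRr1 ?ltW// -(mulVf (lt0r_neq0 r0)) powRrM.
  by apply: gt0_ltr_powR; rewrite ?nnegrE ?powR_ge0// ltW.
rewrite /powR (gt_eqF l0).
under eq_fun do rewrite (gt_eqF (t0 _)).
apply: (@continuous_cvg _ _ _ _ _ (fun n => r * ln (t n)) expR).
  exact: continuous_expR.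
apply: cvgM; first exact: cvg_cst.
apply: (@continuous_cvg _ _ _ _ _ t (@ln R)) => //; exact: continuous_ln.
Qed.

(** Inverse of [phi |-> exp (- phi / 2)] on [(0, 1]]; the maximum with 0 makes it
    nonnegative on the whole line. *)
Definition neg2ln (u : R) : R := Order.max 0 (- 2 * ln u).

Lemma cvg_of_exp_half (p : nat -> R) (u : R) : (forall n, 0 <= p n) ->
  expR (- (p n / 2)) @[n --> \oo] --> u ->
  (p n)%:E @[n --> \oo] --> (if 0 < u then (neg2ln u)%:E else +oo%E).
Proof.
move=> p0 pu; case: ifPn => [u0|].
  apply/fine_cvgP; split; first exact: nearW.
  have pl : p n @[n --> \oo] --> - 2 * ln u.
    rewrite (_ : p = fun n => - 2 * ln (expR (- (p n / 2)))).
      apply: cvgM; first exact: cvg_cst.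
      apply: (@continuous_cvg _ _ _ _ _ (fun n => expR (- (p n / 2))) (@ln R)) => //.
      exact: continuous_ln.
    by apply/funext => n; rewrite expRK; field.
  rewrite /neg2ln max_r//.
  rewrite -(cvg_lim _ pl)//; apply: limr_ge; last exact: nearW.
  by apply/cvg_ex; eexists; exact: pl.
rewrite -leNgt => u0; apply/cvgeryP/cvgryPge => M.
have e0 : 0 < expR (- (M / 2)) by exact: expR_gt0.
move/cvgrPdist_lt : pu => /(_ _ e0); apply: filterS => n.
rewrite distrC => /ltr_normlW; rewrite ltrBlDr => lt_e.
have : expR (- (p n / 2)) < expR (- (M / 2)) by lra.
by rewrite ltr_expR; lra.
Qed.

Hypothesis theta_gt0 : forall j, 0 < theta j.
Hypothesis theta_sum1 : \sum_j theta j = 1.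
Context (A : J -> (X -> R) -> R -> Prop) (B : R).
Hypothesis coneA : forall j, costed_cone (A j).
Hypothesis B_ge0 : 0 <= B.
Hypothesis A_bound : forall (G : J -> X -> R) (c : J -> R),
  (forall j, A j (G j) (c j)) ->
  (\int[mu]_x (\prod_j G j x `^ theta j)%:E <=
   (B * \prod_j c j `^ theta j)%:E)%E.
Hypothesis A_sat : forall j (E : set X), measurable E -> (0 < mu E)%E ->
  exists E' G c, [/\ measurable E', E' `<=` E, (0 < mu E')%E, A j G c &
    {ae mu, forall x, E' x -> 0 < G x}].

Let constraint := {t : J * (X -> R) * R | A t.1.1 t.1.2 t.2}.

Let holds (delta : R) (t : constraint) (phi : J -> X -> R) : Prop :=
  let: (j, G, c) := sval t in
  (\int[mu]_x (G x * phi j x)%:E <= ((B + delta) * (c + delta))%:E)%E.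

Let K (t0 : constraint) (a : seq constraint * {posnum R}) (phi : J -> X -> R) : Prop :=
  admissible theta phi /\
  forall i, (i < size a.1)%N -> holds a.2%:num (nth t0 a.1 i) phi.

Let holds_le (d d' : R) t phi : 0 <= d -> d <= d' -> holds d t phi ->
  holds d' t phi.
Proof.
move=> d0 dd'; rewrite /holds; case: t => -[[j G] c] /= AG /le_trans; apply.
have c0 := cone_cost_ge0 (coneA j) AG.
by have := B_ge0; rewrite lee_fin => B0; apply: ler_pM; lra.
Qed.

Let holds_mid d t phi psi : admissible theta phi -> admissible theta psi ->
  holds d t phi -> holds d t psi ->
  holds d t (fun j x => (phi j x + psi j x) / 2).
Proof.
move=> [mphi phi0 _] [mpsi psi0 _]; rewrite /holds.
case: t => -[[j G] c] /= AG h1 h2.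
have half x : (phi j x + psi j x) / 2 = 2^-1 * phi j x + (1 - 2^-1) * psi j x.
  by field.
under eq_integral do rewrite half.
rewrite (integral_convex mu (cone_meas (coneA j) AG) (mphi j) (mpsi j)
  (fun x => cone_ge0 (coneA j) x AG) (fun x => ltW (phi0 j x))
  (fun x => ltW (psi0 j x))); [|lra..].
set b := (B + d) * (c + d) in h1 h2 *.
have -> : b = 2^-1 * b + (1 - 2^-1) * b by field.
rewrite [leRHS]EFinD [X in (_ <= X + _)%E]EFinM [X in (_ <= _ + X)%E]EFinM.
by apply: leeD; apply: lee_wpmul2l => //; rewrite lee_fin; lra.
Qed.

(** Finite sets of constraints, each with a positive slack, index a directed family
    to which [directed_compactness] applies; [finite_factorization] says that its
    members are nonempty. Fatou's lemma transfers each constraint to the limit,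
    for every slack. The constraint attached to [(G, c)] also makes the limit
    finite almost everywhere on the set where [0 < G], and by saturation such sets
    exhaust [X]. *)
Theorem cone_factorization :
  exists phi : J -> X -> R, [/\ forall j, measurable_fun [set: X] (phi j),
    forall j x, 0 <= phi j x,
    {ae mu, forall x, 1 <= \prod_j phi j x `^ theta j} &
    forall j G c, A j G c -> (\int[mu]_x (G x * phi j x)%:E <= (B * c)%:E)%E].
Proof.
have [j0 _] : exists j : J, true.
  apply: contrapT => /forallNP noJ; move: theta_sum1.
  rewrite big1 => [/eqP|j]; last by have := noJ j.
  by rewrite eq_sym oner_eq0.
pose t0 : constraint := exist _ (j0, (fun=> 0), 0) (cone0 (coneA j0)).
have [||||u mu_ uP] := @directed_compactness R _ X J mu _ (K t0) ([::], 1%:pos).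
- move=> a phi [[mphi phi0 _] _]; split => // j x; exact: ltW.
- move=> a phi psi [aphi hphi] [apsi hpsi]; split.
    rewrite (_ : (fun j x => _) =
        fun j x => 2^-1 * phi j x + (1 - 2^-1) * psi j x).
      by apply: admissible_convex => //; lra.
    by apply/funext => j; apply/funext => x; field.
  by move=> i ilt; apply: holds_mid => //; [exact: hphi|exact: hpsi].
- move=> [F d]; pose F' := t0 :: F.
  pose t (i : 'I_(size F).+1) := sval (nth t0 F' i).
  have [||phi aphi hphi] := @finite_factorization R _ X J mu theta theta_gt0
    theta_sum1 A B coneA B_ge0 A_bound (size F) (fun i => (t i).1.1)
    (fun i => (t i).1.2) (fun i => (t i).2) d%:num.
  + by [].
  + by move=> i; exact: (svalP (nth t0 F' i)).
  + exists phi; split=> // i /= ilt.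
    have := hphi (Ordinal (ilt : i.+1 < (size F).+1)%N).
    by rewrite /holds /t/=; case: (nth t0 F i) => -[[j G] c] /=.
- move=> [F1 d1] [F2 d2].
  exists (F1 ++ F2, (Order.min d1%:num d2%:num)%:pos) => phi [aphi hphi].
  split; split => // i /= ilt.
  + apply: (@holds_le (Order.min d1%:num d2%:num)) => //.
      by rewrite ge_min lexx.
    have := hphi i; rewrite /= nth_cat ilt; apply.
    by rewrite size_cat ltn_addr.
  + apply: (@holds_le (Order.min d1%:num d2%:num)) => //.
      by rewrite ge_min lexx orbT.
    have nlt : (size F1 + i < size F1)%N = false by rewrite ltnNge leq_addr.
    have := hphi (size F1 + i)%N; rewrite /= nth_cat nlt addKn.
    by apply; rewrite size_cat ltn_add2l.
(* the limit as an extended real, with value +oo where [u] vanishes *)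
pose Phi j x : \bar R := if 0 < u j x then (neg2ln (u j x))%:E else +oo%E.
have mneg j : measurable_fun [set: X] (fun x => neg2ln (u j x)).
  apply: measurable_maxr => //; apply: measurable_funM => //.
  exact: (measurableT_comp (@measurable_ln R)).
have mPhi j : measurable_fun [set: X] (Phi j).
  apply: measurable_fun_ifT => //; last exact/measurable_EFinP.
  exact: measurable_fun_ltr.
have neg0 v : 0 <= neg2ln v by rewrite le_max lexx.
have Phi0 j x : (0 <= Phi j x)%E by rewrite /Phi; case: ifP => _; [rewrite lee_fin|exact: leey].
have bound j G c (d : {posnum R}) : A j G c ->
    (\int[mu]_x ((G x)%:E * Phi j x) <= ((B + d%:num) * (c + d%:num))%:E)%E.
  move=> AG; pose t : constraint := exist _ (j, G, c) AG.
  have [phi phiK phiu] := uP ([:: t], d).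
  have phi0 n : admissible theta (phi n) by have [] := phiK n.
  have mphi n k : measurable_fun [set: X] (phi n k) by have [] := phi0 n.
  have phi_gt0 n k x : 0 < phi n k x by have [] := phi0 n.
  have mG := cone_meas (coneA j) AG.
  have G0 x : 0 <= G x := cone_ge0 (coneA j) x AG.
  apply: (@fatou_le _ _ _ mu (fun n x => G x * phi n j x)).
  - by move=> n; exact: measurable_funM.
  - by move=> n x; rewrite mulr_ge0// ltW.
  - by apply: emeasurable_funM => //; exact/measurable_EFinP.
  - by move=> x; rewrite mule_ge0// lee_fin.
  - apply: filterS phiu => x /(_ j) phix.
    have pc := cvg_of_exp_half (fun n => ltW (phi_gt0 n j x)) phix.
    have Gpc : (G x * phi n j x)%:E @[n --> \oo] --> ((G x)%:E * Phi j x)%E.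
      by under eq_fun do rewrite EFinM; apply: cvgeZl.
    by rewrite (cvg_limn_einf_sup Gpc).1.
  - move=> n; have [_ /(_ 0%N erefl)] := phiK n; exact.
have u_pos j G c : A j G c -> {ae mu, forall x, 0 < G x -> 0 < u j x}.
  move=> AG; have mG := cone_meas (coneA j) AG.
  have iGPhi : mu.-integrable [set: X] (fun x => (G x)%:E * Phi j x)%E.
    apply/integrableP; split.
      by apply: emeasurable_funM => //; exact/measurable_EFinP.
    apply: (@le_lt_trans _ _ (((B + 1) * (c + 1))%:E)); last exact: ltry.
    apply: le_trans (bound j G c 1%:pos AG).
    rewrite le_eqVlt; apply/orP; left; apply/eqP; apply: eq_integral => x _.
    by rewrite gee0_abs// mule_ge0// lee_fin (cone_ge0 (coneA j) x AG).
  have := integrable_ae measurableT iGPhi; apply: filterS => x /(_ I) + Gx.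
  by rewrite /Phi; case: ifP => // _; rewrite gt0_muley ?lte_fin.
have u_gt0 j : {ae mu, forall x, 0 < u j x}.
  pose E := [set x | u j x <= 0].
  have mE : measurable E.
    have := mu_ j measurableT _ (measurable_itv `]-oo, (0 : R)]).
    by rewrite setTI (_ : _ @^-1` _ = E)//; apply/seteqP;
      split => x /=; rewrite in_itv.
  exists E; split => //; last by move=> x /= /negP; rewrite -leNgt.
  apply/eqP; rewrite -measure_le0 leNgt; apply/negP => muE.
  have [E' [G [c [mE' E'E muE' AG Gpos]]]] := A_sat j mE muE.
  have : {ae mu, forall x, ~ E' x}.
    apply: filterS2 Gpos (u_pos _ _ _ AG) => x Gx ux E'x.
    by have := ux (Gx E'x); rewrite ltNge => /negP; apply; exact: E'E.
  move=> [N [mN N0 E'N]].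
  move: muE'; rewrite ltNge => /negP; apply.
  rewrite -N0; apply: le_measure; rewrite ?inE// => x E'x; apply: E'N => /=.
  by move=> /(_ E'x).
exists (fun j x => neg2ln (u j x)); split => //.
- have [phi phiK phiu] := uP ([::], 1%:pos).
  have upos : {ae mu, forall x j, 0 < u j x} by exact: filter_forall.
  apply: filterS2 upos phiu => x ux phix.
  have phi_gt0 n j : 0 < phi n j x by have [[_ + _] _] := phiK n.
  have cprod : \prod_j phi n j x `^ theta j @[n --> \oo] -->
      \prod_j neg2ln (u j x) `^ theta j.
    apply: cvg_big => [|j _].
      exact: mul_continuous.
    apply: cvg_powR => //.
    have := cvg_of_exp_half (fun n => ltW (phi_gt0 n j)) (phix j).
    by rewrite ux => /fine_cvgP[].
  rewrite -(cvg_lim _ cprod)//; apply: limr_ge.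
    by apply/cvg_ex; eexists; exact: cprod.
  by apply: nearW => n; have [[_ _ +] _] := phiK n.
- move=> j G c AG; apply/lee_addgt0Pr => e e0.
  have c0 : 0 <= c := cone_cost_ge0 (coneA j) AG.
  have B0 : 0 <= B := B_ge0.
  pose d := Order.min 1 (e / (B + c + 1)).
  have d0 : 0 < d by rewrite lt_min ltr01 divr_gt0//; lra.
  have mG := cone_meas (coneA j) AG.
  have -> : (\int[mu]_x (G x * neg2ln (u j x))%:E =
      \int[mu]_x ((G x)%:E * Phi j x))%E.
    apply: ae_eq_integral => //.
    + by apply/measurable_EFinP; exact: measurable_funM.
    + by apply: emeasurable_funM => //; exact/measurable_EFinP.
    + by apply: filterS (u_gt0 j) => x ux _; rewrite /Phi ux EFinM.
  apply: le_trans (bound j G c (PosNum d0) AG) _ => /=.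
  rewrite -EFinD lee_fin.
  have d1 : d <= 1 by rewrite ge_min lexx.
  have : d * (B + c + 1) <= e.
    by rewrite -ler_pdivlMr ?ge_min ?lexx ?orbT//; lra.
  by nra.
Qed.

End ConeFactorization.

(** * Power means of simple functions *)

Section PowerMean.
Context {R : realType} (p : R).
Hypothesis p_ge1 : 1 <= p.

Let p_gt0 : 0 < p. Proof. exact: lt_le_trans p_ge1. Qed.

Definition pmean (a b : R) : R := (a `^ p + b `^ p) `^ p^-1.

Lemma pmean_ge0 a b : 0 <= pmean a b.
Proof. exact: powR_ge0. Qed.

Lemma powR_pmean a b : pmean a b `^ p = a `^ p + b `^ p.
Proof.
rewrite -powRrM mulVf ?gt_eqF// powRr1// addr_ge0//; exact: powR_ge0.
Qed.

(** The linear minorants of [pmean] on the positive quadrant; this set is stable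
    under decreasing the coefficients, whence rational ones suffice. *)
Definition below_pmean (alpha beta : R) : Prop :=
  forall a b, 0 <= a -> 0 <= b -> alpha * a + beta * b <= pmean a b.

(** The gradient of [pmean] at [(a, b)], in which Hoelder's inequality is an
    equality. *)
Lemma pmean_tangent (a b : R) : 0 <= a -> 0 <= b -> 0 < pmean a b ->
  exists alpha beta, below_pmean alpha beta /\ alpha * a + beta * b = pmean a b.
Proof.
move=> a0 b0; set n := pmean a b => n0.
have [pE|p_neq1] := eqVneq p 1.
  have pm x y : 0 <= x -> 0 <= y -> pmean x y = x + y.
    by move=> x0 y0; rewrite /pmean pE invr1 !powRr1// addr_ge0.
  exists 1, 1; split; last by rewrite !mul1r /n (pm a b a0 b0).
  by move=> x y x0 y0; rewrite (pm x y x0 y0) !mul1r; exact: lexx.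
have p_gt1 : 1 < p by rewrite lt_neqAle eq_sym p_neq1.
pose q := p / (p - 1).
have p10 : 0 < p - 1 by lra.
have q0 : 0 < q by rewrite divr_gt0.
have pq : p^-1 + q^-1 = 1.
  by rewrite /q; field; rewrite !gt_eqF.
have p1q : (p - 1) * q = p by rewrite /q; field; rewrite gt_eqF.
have an0 : 0 <= a / n by rewrite divr_ge0// ltW.
have bn0 : 0 <= b / n by rewrite divr_ge0// ltW.
have sum1 : (a / n) `^ p + (b / n) `^ p = 1.
  have nV : 0 <= n^-1 by rewrite invr_ge0 ltW.
  rewrite !powRM// -mulrDl -powR_pmean -/n -powRM ?(ltW n0)//.
  by rewrite mulfV ?powR1// gt_eqF.
exists ((a / n) `^ (p - 1)), ((b / n) `^ (p - 1)); split.
  move=> x y x0 y0; rewrite ![_ * x]mulrC ![_ * y]mulrC.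
  apply: le_trans (hoelder2 x0 y0 (powR_ge0 _ _) (powR_ge0 _ _) p_gt0 q0 pq) _.
  rewrite -!powRrM p1q sum1 powR1 mulr1; exact: lexx.
have E c : 0 <= c -> (c / n) `^ (p - 1) * c = n * (c / n) `^ p.
  move=> c0; rewrite -(@mulr_powRB1 _ (c / n) p)//; last by rewrite divr_ge0// ltW.
  by rewrite mulrA mulrC; congr (_ * _); field; rewrite gt_eqF.
by rewrite !E// -mulrDr sum1 mulr1.
Qed.

(** A positive operator only sees the linear minorants of [pmean], one null set for
    each of them; countably many determine [pmean]. *)
Lemma pmean_le_of_rat (a b z : R) : 0 <= a -> 0 <= b -> 0 <= z ->
  (forall r s : rat, below_pmean (ratr r) (ratr s) ->
    ratr r * a + ratr s * b <= z) ->
  a `^ p + b `^ p <= z `^ p.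
Proof.
move=> a0 b0 z0 tangents; rewrite -powR_pmean.
apply: ge0_ler_powR; rewrite ?nnegrE ?pmean_ge0//; first exact: ltW.
have [n0|n0] := ltP 0 (pmean a b); last exact: le_trans n0 z0.
have [alpha [beta [tan <-]]] := pmean_tangent a0 b0 n0.
apply/ler_addgt0Pr => e e0.
pose e' := e / (a + b + 1).
have e'0 : 0 < e' by rewrite divr_gt0//; lra.
have [r] := @rat_in_itvoo R (alpha - e') alpha ltac:(lra).
have [s] := @rat_in_itvoo R (beta - e') beta ltac:(lra).
rewrite !in_itv/= => /andP[s1 s2] /andP[r1 r2].
have rs : ratr r * a + ratr s * b <= z.
  apply: tangents => x y x0 y0; apply: le_trans (tan _ _ x0 y0).
  by apply: lerD; apply: ler_wpM2r => //; exact: ltW.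
have : e' * (a + b) <= e.
  rewrite -[X in _ <= X](divfK (x := a + b + 1)); last by rewrite gt_eqF//; lra.
  by rewrite -/e' ler_pM2l//; lra.
by nra.
Qed.

End PowerMean.

Lemma fct_linearE {R : realType} {Y : Type} (a : R) (f g : Y -> R) :
  a *: f + g = (fun y => a * f y + g y).
Proof. by []. Qed.

Section SimpleLp.
Context {R : realType} {dY} {Y : measurableType dY}.
Context (nu : {measure set Y -> \bar R}) (p : R).
Hypothesis p_ge1 : 1 <= p.

Let p_gt0 : 0 < p. Proof. exact: lt_le_trans p_ge1. Qed.

Definition normp (f : Y -> R) : \bar R := (\int[nu]_y (`|f y| `^ p)%:E)%E.

Lemma normp_ge0 f : (0 <= normp f)%E.
Proof. by apply: integral_ge0 => y _; rewrite lee_fin powR_ge0. Qed.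

Lemma LnormE (f : Y -> R) : ('N[nu]_p%:E[EFin \o f] = normp f `^ p^-1)%E.
Proof. by rewrite unlock; congr poweR; apply: eq_integral => y _. Qed.

Lemma simpleLpP (f : Y -> R) : simpleLp nu p f <->
  [/\ measurable_fun [set: Y] f, finite_set (range f) & (normp f < +oo)%E].
Proof.
rewrite /simpleLp/= /finite_norm LnormE; split.
  move=> [/andP[/set_mem mf /set_mem ff] fin]; split => //.
  by apply: lty_poweRy fin; rewrite invr_eq0 gt_eqF.
move=> [mf ff fin]; split; last exact: poweR_lty.
by apply/andP; split; apply/mem_set.
Qed.

Lemma fine_Lnorm_powR (f : Y -> R) : simpleLp nu p f ->
  fine 'N[nu]_p%:E[EFin \o f] `^ p = fine (normp f).
Proof.
move=> /simpleLpP[_ _ fin]; rewrite LnormE.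
have -> : normp f = (fine (normp f))%:E by rewrite fineK// ge0_fin_numE// normp_ge0.
by rewrite poweR_EFin/= -powRrM mulVf ?gt_eqF// powRr1// fine_ge0// normp_ge0.
Qed.

Lemma measurable_normp (f : Y -> R) : measurable_fun [set: Y] f ->
  measurable_fun [set: Y] (fun y => (`|f y| `^ p)%:E).
Proof.
move=> mf; apply/measurable_EFinP.
apply: (measurableT_comp (measurable_powR p)).
exact: measurableT_comp.
Qed.

(** The common source of [simpleLp_linear] and [simpleLp_pmean]. *)
Lemma simpleLp_comp2 (h : R -> R -> R) (C : R) (f g : Y -> R) : 0 <= C ->
  (forall a b, `|h a b| `^ p <= C * (`|a| `^ p + `|b| `^ p)) ->
  measurable_fun [set: Y] (fun y => h (f y) (g y)) ->
  simpleLp nu p f -> simpleLp nu p g -> simpleLp nu p (fun y => h (f y) (g y)).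
Proof.
move=> C0 hC mh /simpleLpP[mf ff fif] /simpleLpP[mg fg fig].
apply/simpleLpP; split; first exact: mh.
  apply: (@sub_finite_set _ _ ((fun ab => h ab.1 ab.2) @` (range f `*` range g))).
    by move=> _ [y _ <-]; exists (f y, g y).
  by apply: finite_image; exact: finite_setX.
apply: (@le_lt_trans _ _ (C%:E * (normp f + normp g))%E); last first.
  apply: lte_mul_pinfty; [by rewrite lee_fin|by []|exact: lte_add_pinfty].
rewrite /normp -ge0_integralD//; [|exact: measurable_normp..].
pose sfg y := ((`|f y| `^ p)%:E + (`|g y| `^ p)%:E)%E.
have msfg : measurable_fun [set: Y] sfg.
  by apply: emeasurable_funD; exact: measurable_normp.
have sfg0 y : [set: Y] y -> (0 <= sfg y)%E.
  by move=> _; rewrite /sfg -EFinD lee_fin addr_ge0// powR_ge0.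
rewrite -(ge0_integralZl_EFin nu measurableT sfg0 msfg C0).
apply: ge0_le_integral => //.
- exact: measurable_normp.
- exact: measurable_funeM.
- by move=> y _; rewrite /sfg -EFinD -EFinM lee_fin hC.
Qed.

Lemma simpleLp0 : simpleLp nu p (fun=> 0).
Proof.
apply/simpleLpP; split => //.
  by apply: (@sub_finite_set _ _ [set 0]) => // _ [y _ <-].
by rewrite /normp (eq_integral (cst 0%E)) ?integral0// => y _; rewrite normr0 powR0// gt_eqF.
Qed.

Lemma simpleLp_linear (a : R) (f g : Y -> R) :
  simpleLp nu p f -> simpleLp nu p g -> simpleLp nu p (a *: f + g).
Proof.
move=> Sf Sg; have [mf _ _] := (simpleLpP f).1 Sf.
have [mg _ _] := (simpleLpP g).1 Sg.
apply: (@simpleLp_comp2 (fun u v => a * u + v) (2 `^ p * (`|a| `^ p + 1))) => //.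
- move=> u v; set m := Order.max (`|a| * `|u|) `|v|.
  have m0 : 0 <= m by rewrite le_max normr_ge0 orbT.
  apply: (@le_trans _ _ ((2 * m) `^ p)).
    apply: ge0_ler_powR; rewrite ?nnegrE//; [exact: ltW|by rewrite mulr_ge0|].
    apply: le_trans (ler_normD _ _) _; rewrite normrM.
    have : `|a| * `|u| <= m by rewrite le_max lexx.
    have : `|v| <= m by rewrite le_max lexx orbT.
    by lra.
  rewrite powRM// -mulrA ler_wpM2l ?powR_ge0//.
  have au := powR_ge0 `|a| p; have pu := powR_ge0 `|u| p; have pv := powR_ge0 `|v| p.
  rewrite /m; case: (leP (`|a| * `|u|) `|v|) => _; last rewrite powRM//; nra.
- by apply: measurable_funD => //; exact: measurable_funM.
Qed.

Lemma simpleLp_scale (a : R) (f : Y -> R) :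
  simpleLp nu p f -> simpleLp nu p (fun y => a * f y).
Proof.
move=> Sf; have := simpleLp_linear a Sf simpleLp0.
by rewrite fct_linearE; under eq_fun do rewrite addr0.
Qed.

Lemma normp_norm (f : Y -> R) : normp (fun y => `|f y|) = normp f.
Proof. by apply: eq_integral => y _; rewrite normr_id. Qed.

Lemma simpleLp_norm (f : Y -> R) :
  simpleLp nu p f -> simpleLp nu p (fun y => `|f y|).
Proof.
move=> /simpleLpP[mf ff fin]; apply/simpleLpP; split.
- exact: measurableT_comp.
- apply: (@sub_finite_set _ _ (Num.norm @` range f)); last exact: finite_image.
  by move=> _ [y _ <-]; exists (f y).
- by rewrite normp_norm.
Qed.

Lemma normp_scale (a : R) (f : Y -> R) : 0 <= a ->
  measurable_fun [set: Y] f ->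
  normp (fun y => a * f y) = ((a `^ p)%:E * normp f)%E.
Proof.
move=> a0 mf; rewrite /normp -ge0_integralZl_EFin ?powR_ge0//; last first.
  exact: measurable_normp.
by apply: eq_integral => y _; rewrite normrM ger0_norm// powRM// EFinM.
Qed.

Section Pmean.
Context (f g : Y -> R).
Hypothesis f_ge0 : forall y, 0 <= f y.
Hypothesis g_ge0 : forall y, 0 <= g y.
Hypothesis Sf : simpleLp nu p f.
Hypothesis Sg : simpleLp nu p g.

Lemma simpleLp_pmean : simpleLp nu p (fun y => pmean p (f y) (g y)).
Proof.
have [mf _ _] := (simpleLpP f).1 Sf; have [mg _ _] := (simpleLpP g).1 Sg.
have absE h : (forall y, 0 <= h y) -> (fun y : Y => `|h y|) = h :> (Y -> R).
  by move=> h0; apply/funext => y; rewrite ger0_norm.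
rewrite -(absE f f_ge0) -(absE g g_ge0).
apply: (@simpleLp_comp2 (fun a b => pmean p `|a| `|b|) 1) => //.
- by move=> a b; rewrite ger0_norm ?pmean_ge0// powR_pmean// mul1r.
- rewrite /pmean; apply: (measurableT_comp (measurable_powR _)).
  by apply: measurable_funD; apply: (measurableT_comp (measurable_powR p));
    exact: measurableT_comp.
Qed.

Lemma normp_pmean :
  (normp (fun y => pmean p (f y) (g y)) = normp f + normp g)%E.
Proof.
have [mf _ _] := (simpleLpP f).1 Sf; have [mg _ _] := (simpleLpP g).1 Sg.
rewrite /normp -ge0_integralD//; [|exact: measurable_normp..].
apply: eq_integral => y _.
by rewrite ger0_norm ?pmean_ge0// powR_pmean// !ger0_norm.
Qed.

End Pmean.
End SimpleLp.

(** * The cone of a positive operator *)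

Section OperatorCone.
Context {R : realType} {dX} {X : measurableType dX}.
Context (mu : {measure set X -> \bar R}).

Lemma ae_forall_countable {I : countType} (P : I -> X -> Prop) :
  (forall i, {ae mu, forall x, P i x}) -> {ae mu, forall x, forall i, P i x}.
Proof.
move=> aeP.
pose Q n x := if unpickle n is Some i then P i x else True.
have : {ae mu, forall x, forall n, Q n x}.
  apply: ae_foralln => n; rewrite /Q.
  by case: (unpickle n) => [i|]; [exact: aeP|exact: filterE].
by apply: filterS => x Qx i; have := Qx (pickle i); rewrite /Q pickleK.
Qed.

Context {dY} {Y : measurableType dY} (nu : {measure set Y -> \bar R}) (p : R).
Hypothesis p_ge1 : 1 <= p.

Let p_gt0 : 0 < p. Proof. exact: lt_le_trans p_ge1. Qed.

Local Notation S := (simpleLp nu p).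

Context (T : (Y -> R) -> X -> R).
Hypothesis T_meas : measurable_valued S T.
Hypothesis T_lin : linear_operator mu S T.
Hypothesis T_pos : positive_operator mu S T.

Let S0 : S (fun=> 0) := simpleLp0 nu p_ge1.

Lemma operator0 : {ae mu, forall x, T (fun=> 0) x = 0}.
Proof.
have := T_lin 1 S0 S0.
rewrite (_ : _ + _ = fun=> 0); last by apply/funext => y; rewrite fct_linearE mulr0 addr0.
by apply: filterS => x; lra.
Qed.

Lemma operatorZ (a : R) (f : Y -> R) : S f ->
  {ae mu, forall x, T (fun y => a * f y) x = a * T f x}.
Proof.
move=> Sf; have := T_lin a Sf S0.
rewrite (_ : _ + _ = fun y => a * f y); last first.
  by apply/funext => y; rewrite fct_linearE addr0.
by apply: filterS2 operator0 => x -> ->; rewrite addr0.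
Qed.

Lemma operator_mono (f g : Y -> R) : S f -> S g -> (forall y, f y <= g y) ->
  {ae mu, forall x, T f x <= T g x}.
Proof.
move=> Sf Sg fg.
have gf0 y : 0 <= (-1 *: f + g) y by rewrite fct_linearE; have := fg y; lra.
apply: filterS2 (T_pos (simpleLp_linear p_ge1 (-1) Sf Sg) gf0) (T_lin (-1) Sf Sg).
move=> x h e; have : 0 <= -1 * T f x + T g x by rewrite -e; exact: h.
by lra.
Qed.

Lemma operator_norm (f : Y -> R) : S f ->
  {ae mu, forall x, `|T f x| <= T (fun y => `|f y|) x}.
Proof.
move=> Sf; have Sn := simpleLp_norm p_ge1 Sf.
have le1 : {ae mu, forall x, T f x <= T (fun y => `|f y|) x}.
  by apply: operator_mono => // y; exact: ler_norm.
have SN : S (fun y => -1 * f y) by exact: simpleLp_scale.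
have le2 : {ae mu, forall x, T (fun y => -1 * f y) x <= T (fun y => `|f y|) x}.
  by apply: operator_mono => // y; rewrite mulN1r -normrN; exact: ler_norm.
have := operatorZ (-1) Sf.
apply: filterS3 le1 le2 => x l1 l2 eN; rewrite ler_norml l1 andbT.
by move: l2; rewrite eN; lra.
Qed.

(** Reverse Minkowski: every tangent line below [pmean] yields a linear lower
    bound on [T (pmean f g)], and countably many of them suffice. *)
Lemma operator_pmean (f g : Y -> R) : S f -> S g ->
  (forall y, 0 <= f y) -> (forall y, 0 <= g y) ->
  {ae mu, forall x, T f x `^ p + T g x `^ p <=
    T (fun y => pmean p (f y) (g y)) x `^ p}.
Proof.
move=> Sf Sg f0 g0.
have SF := simpleLp_pmean p_ge1 f0 g0 Sf Sg.
have tangents : {ae mu, forall x, forall rs : rat * rat,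
    below_pmean p (ratr rs.1 : R) (ratr rs.2 : R) ->
    ratr rs.1 * T f x + ratr rs.2 * T g x <= T (fun y => pmean p (f y) (g y)) x}.
  apply: ae_forall_countable => -[r s] /=.
  have [below|nbelow] := pselect (below_pmean p (ratr r : R) (ratr s : R)); last first.
    exact: filterE.
  have Ssg : S (fun y => ratr s * g y) by exact: simpleLp_scale.
  have Srs := simpleLp_linear p_ge1 (ratr r) Sf Ssg.
  have : {ae mu, forall x, T (ratr r *: f + (fun y => ratr s * g y)) x <=
      T (fun y => pmean p (f y) (g y)) x}.
    by apply: operator_mono => // y; rewrite fct_linearE; exact: below.
  apply: filterS3 (T_lin (ratr r) Sf Ssg) (operatorZ (ratr s) Sg) => x e1 e2 + _.
  by rewrite e1 e2.
have F0 y : 0 <= pmean p (f y) (g y) by exact: pmean_ge0.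
have TF := T_pos SF F0.
have Tfg : {ae mu, forall x, 0 <= T f x /\ 0 <= T g x}.
  by apply: filterS2 (T_pos Sf f0) (T_pos Sg g0) => x.
apply: filterS3 tangents Tfg TF => x tan [Tf0 Tg0] TF0.
by apply: pmean_le_of_rat => // r s below; exact: (tan (r, s)).
Qed.

(** The inequalities, instead of equalities, make this a set closed under addition
    in both components. *)
Definition operator_cost (G : X -> R) (c : R) : Prop :=
  [/\ measurable_fun [set: X] G, forall x, 0 <= G x &
    exists f, [/\ S f, forall y, 0 <= f y,
      {ae mu, forall x, G x <= T f x `^ p} & (normp nu p f <= c%:E)%E]].

(** The sum of two pairs is witnessed by the power mean of the two functions, which
    is additive for the power of the norm and superadditive under [T]. *)
Lemma operator_cone : costed_cone operator_cost.
Proof.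
split.
- by move=> G c [].
- by move=> G c x [].
- move=> G c [_ _ [f [_ _ _ fc]]].
  by rewrite -lee_fin; apply: le_trans fc; exact: normp_ge0.
- split => //; exists (fun=> 0); split => //.
  + by apply: filterE => x; exact: powR_ge0.
  + rewrite /normp (eq_integral (cst 0%E)) ?integral0// => y _.
    by rewrite normr0 powR0// gt_eqF.
- move=> G c G' c' [mG G0 [f [Sf f0 Gf fc]]] [mG' G'0 [g [Sg g0 Gg gc]]].
  split; [exact: measurable_funD|by move=> x; rewrite addr_ge0|].
  exists (fun y => pmean p (f y) (g y)); split.
  + exact: simpleLp_pmean.
  + by move=> y; exact: pmean_ge0.
  + apply: filterS3 Gf Gg (operator_pmean Sf Sg f0 g0) => x Gx G'x.
    by apply: le_trans; exact: lerD.
  + by rewrite normp_pmean// EFinD leeD.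
- move=> s G c s0 [mG G0 [f [Sf f0 Gf fc]]].
  split; [exact: measurable_funM|by move=> x; rewrite mulr_ge0|].
  pose r := s `^ p^-1.
  have r0 : 0 <= r by exact: powR_ge0.
  have rp : r `^ p = s by rewrite -powRrM mulVf ?gt_eqF// powRr1.
  exists (fun y => r * f y); split.
  + exact: simpleLp_scale.
  + by move=> y; rewrite mulr_ge0.
  + apply: filterS3 Gf (operatorZ r Sf) (T_pos Sf f0) => x Gx -> Tx.
    by rewrite powRM// rp ler_wpM2l.
  + have [mf _ _] := (simpleLpP nu p_ge1 f).1 Sf.
    by rewrite normp_scale// rp EFinM lee_wpmul2l.
Qed.

Lemma operator_cost_abs (f : Y -> R) : S f ->
  operator_cost (fun x => `|T f x| `^ p) (fine (normp nu p f)).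
Proof.
move=> Sf; have [mf _ fin] := (simpleLpP nu p_ge1 f).1 Sf.
split.
- apply: (measurableT_comp (measurable_powR p)).
  by apply: measurableT_comp => //; exact: T_meas.
- by move=> x; exact: powR_ge0.
exists (fun y => `|f y|); split => //; first exact: simpleLp_norm.
  apply: filterS (operator_norm Sf) => x Tx.
  apply: ge0_ler_powR; rewrite ?nnegrE//; first exact: ltW.
  exact: le_trans Tx.
rewrite normp_norm fineK// ge0_fin_numE//; exact: normp_ge0.
Qed.

End OperatorCone.

(** * The factorization theorem *)

Theorem theorem1p4 (R : realType) (dX : measure_display)
    (X : measurableType dX) (mu : {sigma_finite_measure set X -> \bar R})
    (d : nat) (dY : 'I_d -> measure_display)
    (Y : forall j : 'I_d, measurableType (dY j))
    (nu : forall j : 'I_d, {measure set (Y j) -> \bar R})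
    (p theta : 'I_d -> R)
    (p_ge1 : forall j, 1 <= p j)
    (theta_ge0 : forall j, 0 <= theta j)
    (theta_sum1 : \sum_(j < d) theta j = 1)
    (T : forall j : 'I_d, (Y j -> R) -> X -> R)
    (T_meas : forall j, measurable_valued (simpleLp (nu j) (p j)) (T j))
    (T_lin : forall j, linear_operator mu (simpleLp (nu j) (p j)) (T j))
    (T_pos : forall j, positive_operator mu (simpleLp (nu j) (p j)) (T j))
    (T_sat : forall j, saturates mu (simpleLp (nu j) (p j)) (T j))
    (B : R) (B_ge0 : 0 <= B)
    (hB : forall f : (forall j : 'I_d, Y j -> R),
      (forall j, simpleLp (nu j) (p j) (f j)) ->
      (forall j y, 0 <= f j y) ->
      (\int[mu]_x (\prod_(j < d) (T j (f j) x `^ (p j * theta j)))%:E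
       <= (B * \prod_(j < d)
             (fine 'N[nu j]_(p j)%:E[EFin \o f j] `^ (p j * theta j)))%:E)%E) :
  exists phi : 'I_d -> X -> R,
    [/\ (forall j, measurable_fun [set: X] (phi j)),
        (forall j x, 0 <= phi j x),
        {ae mu, forall x, 1 <= \prod_(j < d) (phi j x `^ theta j)} &
        forall (j : 'I_d) (f : Y j -> R), simpleLp (nu j) (p j) f ->
          ((\int[mu]_x (`|T j f x| `^ p j * phi j x)%:E) `^ (p j)^-1
           <= (B `^ (p j)^-1)%:E * 'N[nu j]_(p j)%:E[EFin \o f])%E].
Proof.
(* only the indices with a positive exponent carry a constraint *)
pose A := [pred j : 'I_d | 0 < theta j].
pose J : finType := {j : 'I_d | j \in A}.
pose mk j (jA : j \in A) : J := exist _ j jA.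
have thetaE0 j : j \notin A -> theta j = 0.
  by rewrite inE -leNgt => tj; apply/eqP; rewrite eq_le tj theta_ge0.
pose cost (j : J) := operator_cost mu (nu (val j)) (p (val j)) (T (val j)).
have cone j : costed_cone (cost j) by exact: operator_cone.
have theta'0 (j : J) : 0 < theta (val j) by exact: (valP j).
have theta'1 : \sum_(j : J) theta (val j) = 1.
  rewrite -(big_sub (op := +%R) A) -theta_sum1 big_mkcond/=.
  by apply: eq_bigr => j _; case: ifPn => // /thetaE0.
have prodE (F : 'I_d -> R) :
    \prod_(j < d) F j `^ theta j = \prod_(j : J) F (val j) `^ theta (val j).
  rewrite -(big_sub (op := *%R) A (fun j => F j `^ theta j)) [RHS]big_mkcond/=.
  by apply: eq_bigr => j _; case: ifPn => // /thetaE0 ->; rewrite powRr0.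
have bound (G : J -> X -> R) (c : J -> R) : (forall j, cost j (G j) (c j)) ->
    (\int[mu]_x (\prod_j G j x `^ theta (val j))%:E <=
     (B * \prod_j c j `^ theta (val j))%:E)%E.
  move=> costG.
  have wit (j : 'I_d) : exists f : Y j -> R, [/\ simpleLp (nu j) (p j) f,
      forall y, 0 <= f y & forall jA : j \in A,
      {ae mu, forall x, G (mk j jA) x <= T j f x `^ p j} /\
      (normp (nu j) (p j) f <= (c (mk j jA))%:E)%E].
    have [jA|jA] := pselect (is_true (j \in A)); last first.
      by exists (fun=> 0); split => //; exact: simpleLp0.
    have [_ _ [f [Sf f0 Gf fc]]] := costG (mk j jA).
    by exists f; split => // jA'; rewrite (bool_irrelevance jA' jA).
  pose f j := sval (cid (wit j)).
  have Sf j : simpleLp (nu j) (p j) (f j) by rewrite /f; case: cid => ? [].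
  have f0 j y : 0 <= f j y by rewrite /f; case: cid => ? [].
  have Gf (j : J) :
      {ae mu, forall x, G j x <= T (val j) (f (val j)) x `^ p (val j)}.
    by case: j => j jA; have [_ _ /(_ jA)[]] := svalP (cid (wit j)).
  have fc (j : J) : (normp (nu (val j)) (p (val j)) (f (val j)) <= (c j)%:E)%E.
    by case: j => j jA; have [_ _ /(_ jA)[]] := svalP (cid (wit j)).
  have G0 j x : 0 <= G j x by have [] := costG j.
  have mG j : measurable_fun [set: X] (G j) by have [] := costG j.
  apply: (@le_trans _ _ (\int[mu]_x
      (\prod_(j < d) (T j (f j) x `^ (p j * theta j)))%:E)%E).
    apply: ae_ge0_le_integral => //.
    - by move=> x _; rewrite lee_fin prodr_ge0// => j _; exact: powR_ge0.
    - by apply/measurable_EFinP; exact: measurable_prod_powR.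
    - by move=> x _; rewrite lee_fin prodr_ge0// => j _; exact: powR_ge0.
    - apply/measurable_EFinP; apply: measurable_prod => j _.
      by apply: (measurableT_comp (measurable_powR _)); exact: T_meas.
    - have : {ae mu, forall x (j : J), G j x <= T (val j) (f (val j)) x `^ p (val j)}.
        exact: filter_forall.
      apply: filterS => x Gx _; rewrite lee_fin.
      under [leRHS]eq_bigr do rewrite powRrM.
      rewrite (prodE (fun j => T j (f j) x `^ p j)).
      apply: ler_prod => j _; rewrite powR_ge0/=.
      by apply: ge0_ler_powR; rewrite ?nnegrE ?powR_ge0//; exact: ltW.
  apply: le_trans (hB f Sf f0) _; rewrite lee_fin; apply: ler_wpM2l => //.
  under [leLHS]eq_bigr do rewrite powRrM.
  rewrite (prodE (fun j => fine 'N[nu j]_(p j)%:E[EFin \o f j] `^ p j)).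
  apply: ler_prod => j _; rewrite powR_ge0/= fine_Lnorm_powR//.
  have fin := fine_ge0 (normp_ge0 (nu (val j)) (p (val j)) (f (val j))).
  have le_c : fine (normp (nu (val j)) (p (val j)) (f (val j))) <= c j.
    have [_ _ nfin] := (simpleLpP (nu (val j)) (p_ge1 (val j)) _).1 (Sf (val j)).
    by rewrite -lee_fin fineK// ge0_fin_numE// normp_ge0.
  apply: ge0_ler_powR; rewrite ?nnegrE//.
  exact: le_trans le_c.
have sat (j : J) (E : set X) : measurable E -> (0 < mu E)%E ->
    exists E' G c, [/\ measurable E', E' `<=` E, (0 < mu E')%E, cost j G c &
      {ae mu, forall x, E' x -> 0 < G x}].
  move=> mE muE; have [E' [mE' E'E muE' [h Sh hpos]]] := T_sat (val j) E mE muE.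
  exists E', (fun x => `|T (val j) h x| `^ p (val j)),
    (fine (normp (nu (val j)) (p (val j)) h)); split => //.
    exact: operator_cost_abs.
  by apply: filterS hpos => x hx /hx; exact: powR_gt0.
have [phi [mphi phi0 phi1 phiB]] :=
  cone_factorization theta'0 theta'1 cone B_ge0 bound sat.
pose phi' j := if insub j is Some i then phi i else fun=> 0.
have phi'E (i : J) : phi' (val i) = phi i by rewrite /phi' valK.
exists phi'; split.
- by move=> j; rewrite /phi'; case: insub.
- by move=> j x; rewrite /phi'; case: insub.
- apply: filterS phi1 => x phix; rewrite (prodE (fun j => phi' j x)).
  by under eq_bigr do rewrite phi'E.
- move=> j f Sf.
  have [mf _ fin] := (simpleLpP (nu j) (p_ge1 j) f).1 Sf.
  have pj0 : 0 < p j by exact: lt_le_trans (p_ge1 j).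
  have [jA|jA] := boolP (j \in A); last first.
    rewrite (eq_integral (cst 0%E)) => [|x _].
      by rewrite integral0 poweR0r ?invr_eq0 ?gt_eqF// mule_ge0 ?lee_fin ?powR_ge0// Lnorm_ge0.
    by rewrite /phi' insubN// mulr0.
  have := phiB (mk j jA) _ _ (operator_cost_abs (p_ge1 j) (T_meas j) (T_lin j) (T_pos j) Sf).
  rewrite -phi'E/= EFinM fineK ?ge0_fin_numE ?normp_ge0// => le_int.
  rewrite LnormE -poweR_EFin -poweRM ?lee_fin ?normp_ge0//.
  apply: gt0_ler_poweR => //.
  + by rewrite invr_ge0 ltW.
  + rewrite in_itv/= leey andbT; apply: integral_ge0 => x _.
    by rewrite lee_fin mulr_ge0 ?powR_ge0// /phi'; case: insub.
  + by rewrite in_itv/= leey andbT mule_ge0 ?lee_fin ?normp_ge0.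
Qed.
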